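(* Let $n\ge2$ and let $w=w_1w_2\cdots w_n$ be an element of $\mathfrak{B}_n$. Then $w$ is separable if and only if it avoids the patterns $\underline{2}1$, $2\underline{1}$, $3142$, $2413$, $\underline{3}\,\underline{1}\,\underline{4}\,\underline{2}$, and $\underline{2}\,\underline{4}\,\underline{1}\,\underline{3}$.
   Context: Notation: $[n]=\{1,\dots,n\}$; an underlined number is negative, $\underline{k}=-k$. $\mathfrak{B}_n$ is the group (under composition, $(uv)(i)=u(v(i))$) of signed permutations of $[n]$, i.e. bijections $w$ of $\{\pm1,\dots,\pm n\}$ with $w(-i)=-w(i)$; one-line notation is $w=w_1\cdots w_n$ with $w_i=w(i)$, $i\in[n]$. $\mathfrak{B}_n$ is the Weyl group of type $B_n$, acting on $\mathbb{R}^n$ by $we_i=e_{w_i}$ with $e_{-i}=-e_i$, with root system $\Phi=\{\pm e_i\mid i\in[n]\}\cup\{\pm e_i\pm e_j\mid 1\le i<j\le n\}$, positive roots $\Phi^+=\{\pm e_i+e_j\mid 1\le i<j\le n\}\cup\{e_i\mid i\in[n]\}$, and simple roots $\Delta=\{\alpha_0=e_1\}\cup\{\alpha_i=-e_i+e_{i+1}\mid i\in[n-1]\}$. Separable elements: let $\Phi$ be a crystallographic root system with simple system $\Delta$, positive system $\Phi^+$ and Weyl group $W(\Phi)$. $I_\Phi(w)=\{\alpha\in\Phi^+\mid w\alpha\in-\Phi^+\}$; on $\Phi^+$, $\alpha\le\beta$ iff $\beta-\alpha$ is a nonnegative integral combination of simple roots. For a linear subspace $V$ of $\mathrm{span}(\Phi)$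 and $\Phi'=\Phi\cap V$ (with positive system $\Phi^+\cap V$), $w|_{\Phi'}$ is the unique $w'\in W(\Phi')$ with $I_{\Phi'}(w')=I_\Phi(w)\cap V$. An element $w\in W(\Phi)$ is separable (recursively) if one of the following holds: (S1) $\Phi$ is of type $A_1$; (S2) $\Phi=\bigoplus\Phi_i$ is reducible and $w|_{\Phi_i}$ is separable for each $i$; (S3) $\Phi$ is irreducible and there exists $\alpha_i\in\Delta$ such that $w|_{\Phi_J}\in W(\Phi_J)$ is separable, where $\Phi_J$ is the subsystem generated by $J=\Delta\setminus\{\alpha_i\}$, and either $\{\beta\in\Phi^+\mid\beta\ge\alpha_i\}\subset I_\Phi(w)$ (equality allowed) or $\{\beta\in\Phi^+\mid\beta\ge\alpha_i\}\cap I_\Phi(w)=\emptyset$. (The identity of the trivial group is regarded as separable.) Patterns: for a sequence $a=a_1\cdots a_m$ of nonzero reals, the standard signed permutation $\mathrm{sts}(a)$ is the unique $v\in\mathfrak{B}_m$ with $\{i\mid v_i<0\}=\{i\mid a_i<0\}$ and, for all $1\le i<j\le m$, $|v_i|<|v_j|\Leftrightarrow|a_i|\le|a_j|$. A signed permutation $w\in\mathfrak{B}_n$ contains the pattern $u\in\mathfrak{B}_m$ ($m\le n$) if there are $1\le i_1<\cdots<i_m\le n$ with $\mathrm{sts}(w_{i_1}\cdots w_{i_m})=u$; otherwise (in particular if $m>n$) it avoids $u$. *)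

(* Defs.v *)
From HB Require Import structures.
From mathcomp Require Import all_boot all_order all_algebra all_fingroup.

Set Implicit Arguments.
Unset Strict Implicit.
Unset Printing Implicit Defensive.

Import Order.TTheory GRing.Theory Num.Theory.
Local Open Scope ring_scope.

(** * Signed permutations *)

(* The set {±1, ..., ±n}: the pair (b, i) stands for (-1)^b (i + 1), so that
   the letter k of the usual 1-based notation is (false, k - 1). *)
Definition letter (n : nat) : finType := (bool * 'I_n)%type.

Definition letter_opp n (x : letter n) : letter n := (~~ x.1, x.2).

Definition letter_val n (x : letter n) : int := (-1) ^+ x.1 * (x.2.+1)%:Z.

(* The product of {perm _} composes from left to right, i.e. it is opposite to
   (uv)(i) = u(v(i)); nothing below depends on the product. *)
Definition signed_perms n : {set {perm letter n}} :=
  [set w : {perm letter n} |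
    [forall x : letter n, w (letter_opp x) == letter_opp (w x)]].

Definition entry n (w : {perm letter n}) (i : 'I_n) : int :=
  letter_val (w (false, i)).

Definition one_line n (w : {perm letter n}) : seq int :=
  [seq entry w i | i <- enum 'I_n].

(** * Patterns *)

(* v is the standard signed permutation of a_1 ... a_m (unique when it exists). *)
Definition is_sts (T : realDomainType) m (a : 'I_m -> T) (v : {perm letter m}) :
    Prop :=
  [/\ v \in signed_perms m,
      forall i : 'I_m, (entry v i < 0) = (a i < 0) &
      forall i j : 'I_m, (i < j)%N ->
        (`|entry v i| < `|entry v j|) = (`|a i| <= `|a j|)].

Definition contains n (w : {perm letter n}) m (u : {perm letter m}) : Prop :=
  exists2 f : 'I_m -> 'I_n,
    forall i j : 'I_m, (i < j)%N -> (f i < f j)%N &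
    is_sts (fun i => entry w (f i)) u.

(* Avoidance of the signed permutation whose one-line notation is p; meaningful
   only if there is one, i.e. if the absolute values of the entries of p are a
   permutation of 1, ..., size p. *)
Definition avoids n (w : {perm letter n}) (p : seq int) : Prop :=
  ~ exists u : {perm letter (size p)}, one_line u = p /\ contains w u.

(** * Root systems and Weyl groups *)

Section RootSystems.

Variables (R : realFieldType) (n : nat).

Local Notation V := 'cV[R]_n.

Definition dot (a b : V) : R := \sum_i a i 0 * b i 0.

(* A root system in R^n with its positive and simple roots; the sequences only
   matter through their members. The axioms of a crystallographic root system
   are not recorded: the notions below are only meant for actual root systems,
   and the recursion in [separable] never leaves them. *)
Record root_data := RootData {
  roots : seq V;
  pos_roots : seq V;
  simple_roots : seq V
}.

Definition reflection (a : V) : 'M[R]_n :=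
  1%:M - (2%:R / dot a a) *: (a *m a^T).

(* Matrices act on column vectors. The Weyl group of a subsystem is regarded as
   acting on all of R^n, trivially on the orthogonal of the subsystem. *)
Inductive weyl (Phi : root_data) : 'M[R]_n -> Prop :=
| weyl_id : weyl Phi 1%:M
| weyl_refl (a : V) (w : 'M[R]_n) :
    a \in roots Phi -> weyl Phi w -> weyl Phi (reflection a *m w).

Definition inversions (Phi : root_data) (w : 'M[R]_n) : seq V :=
  [seq a <- pos_roots Phi | - (w *m a) \in pos_roots Phi].

Definition root_le (Phi : root_data) (a b : V) : Prop :=
  exists c : V -> nat, b - a = \sum_(d <- simple_roots Phi) d *+ c d.

(* The subsystem cut out by a subspace U. Its simple roots are the simple roots
   lying in U only if U is spanned by simple roots, which is the case for every
   subspace considered in [separable]. *)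
Definition subsystem (Phi : root_data) (U : {vspace V}) : root_data :=
  RootData [seq a <- roots Phi | a \in U]
           [seq a <- pos_roots Phi | a \in U]
           [seq a <- simple_roots Phi | a \in U].

Definition is_restriction (Phi : root_data) (U : {vspace V})
    (w w' : 'M[R]_n) : Prop :=
  weyl (subsystem Phi U) w' /\
  inversions (subsystem Phi U) w' =i [seq a <- inversions Phi w | a \in U].

Definition reducible (Phi : root_data) : Prop :=
  exists A B : seq V,
    [/\ A <> [::], B <> [::], roots Phi =i A ++ B &
        forall a b, a \in A -> b \in B -> dot a b = 0].

Definition irreducible (Phi : root_data) : Prop :=
  roots Phi <> [::] /\ ~ reducible Phi.

Definition type_A1 (Phi : root_data) : Prop :=
  exists2 a : V, a != 0 & roots Phi =i [:: a; - a].

(* Phi is the orthogonal sum of the irreducible systems cut out by the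
   subspaces U i. *)
Definition decomposition (Phi : root_data) k (U : 'I_k -> {vspace V}) : Prop :=
  [/\ forall i, U i = <<roots (subsystem Phi (U i))>>%VS,
      forall i, irreducible (subsystem Phi (U i)),
      forall a, a \in roots Phi -> exists i, a \in U i &
      forall i j a b, i != j ->
        a \in roots (subsystem Phi (U i)) ->
        b \in roots (subsystem Phi (U j)) -> dot a b = 0].

Definition span_minus (Phi : root_data) (a : V) : {vspace V} :=
  <<[seq d <- simple_roots Phi | d != a]>>%VS.

(* For w in the Weyl group of Phi. *)
Inductive separable : root_data -> 'M[R]_n -> Prop :=
| separable_trivial (Phi : root_data) (w : 'M[R]_n) :
    roots Phi = [::] -> separable Phi w
| separable_A1 (Phi : root_data) (w : 'M[R]_n) :
    type_A1 Phi -> separable Phi w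
| separable_reducible (Phi : root_data) (w : 'M[R]_n) k
    (U : 'I_k -> {vspace V}) (w' : 'I_k -> 'M[R]_n) :
    (1 < k)%N -> decomposition Phi U ->
    (forall i, is_restriction Phi (U i) w (w' i)) ->
    (forall i, separable (subsystem Phi (U i)) (w' i)) ->
    separable Phi w
| separable_irreducible (Phi : root_data) (w : 'M[R]_n) (a : V)
    (w' : 'M[R]_n) :
    irreducible Phi -> a \in simple_roots Phi ->
    is_restriction Phi (span_minus Phi a) w w' ->
    separable (subsystem Phi (span_minus Phi a)) w' ->
    (forall b, b \in pos_roots Phi -> root_le Phi a b ->
       b \in inversions Phi w) \/
    (forall b, b \in pos_roots Phi -> root_le Phi a b ->
       b \notin inversions Phi w) ->
    separable Phi w.

(** * Type B *)

Definition basis_vec (x : letter n) : V := (-1) ^+ x.1 *: delta_mx x.2 0.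

Local Notation e i := (basis_vec (false, i)).

Definition posB : seq V :=
  [seq e i | i <- enum 'I_n] ++
  [seq e j + e i | i <- enum 'I_n,
                   j <- [seq j : 'I_n <- enum 'I_n | (i < j)%N]] ++
  [seq e j - e i | i <- enum 'I_n,
                   j <- [seq j : 'I_n <- enum 'I_n | (i < j)%N]].

Definition simpleB : seq V :=
  [seq e i | i <- [seq i : 'I_n <- enum 'I_n | val i == 0%N]] ++
  [seq e j - e i | i <- enum 'I_n,
                   j <- [seq j : 'I_n <- enum 'I_n | val j == i.+1]].

Definition typeB : root_data :=
  RootData (posB ++ [seq - a | a <- posB]) posB simpleB.

(* The action of w on R^n: e_i is sent to e_(w i). *)
Definition signed_perm_mx (w : {perm letter n}) : 'M[R]_n :=
  \matrix_(i, j) basis_vec (w (false, j)) i 0.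

End RootSystems.

(* Main.v *)
(* Write a vector through its coefficients on the simple roots: a root is
   positive iff its height (the sum of the coefficients) is, a parabolic
   subsystem with simple roots J consists of the roots whose coefficients vanish
   off J, and beta >= alpha_c for a positive root beta iff its c-th coefficient
   is positive. In one-line notation w, avoiding the six patterns means that
   i < j and opposite signs of w_i, w_j force |w_i| < |w_j|, and that no w_i w_j
   w_k w_l is ordered like 2413 or 3142.

   Separable implies avoiding: every inequality in an excluded pattern is the
   (non-)inversion of a root. If all the roots of the pattern lie in one smaller
   subsystem, induction applies; otherwise some of them lie above the pivot
   alpha_c, hence are all inverted or all not, which no excluded pattern allows.

   Avoiding implies separable: in an irreducible parabolic subsystem J is an
   interval, and a pivot is a cut of the corresponding stretch of w into two
   parts, one entirely above the other (in absolute value, with constant sign,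
   when alpha_0 is in J). Such a cut is found by induction on the stretch,
   removing its last entry: the cut of the rest survives, or the new entry
   splits the lower part of it. *)

Require Import Defs.
From mathcomp Require Import all_boot all_order all_algebra all_fingroup.
From mathcomp Require Import zify ring lra.
From Stdlib Require Import Classical.

Set Implicit Arguments.
Unset Strict Implicit.
Unset Printing Implicit Defensive.

Import Order.TTheory GRing.Theory Num.Theory.
Local Open Scope ring_scope.

(** * Cutting stretches of an integer sequence *)

(* No four positions carry values in the relative order 2413 or 3142. *)
Definition noninterlaced (x : nat -> int) (n : nat) : Prop :=
  forall i j k l, (i < j < k)%N -> (k < l < n)%N ->
    ~ (x k < x i /\ x i < x l /\ x l < x j) /\
    ~ (x j < x l /\ x l < x i /\ x i < x k).

Definition mixed_increasing (x : nat -> int) (n : nat) : Prop :=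
  forall i j, (i < j < n)%N -> (x i < 0) != (x j < 0) -> `|x i| < `|x j|.

Lemma noninterlacedN x n : noninterlaced x n -> noninterlaced (fun i => - x i) n.
Proof. by move=> xP i j k l ijk kln; have := xP i j k l ijk kln; lia. Qed.

(** The new entry [x r.+1] is compared with the lower part [[p, c)]. If it exceeds all of it, the
    cut at [c] survives. Otherwise, from the first larger entry on, avoidance of 3142 makes the rest
    of the lower part larger too, and the cut moves there, or to [r.+1] when that first entry is at
    [p]. *)
Lemma interval_cut_step (x : nat -> int) (n p c r : nat) :
  noninterlaced x n -> {in gtn n &, injective x} ->
  (p < c <= r)%N -> (r.+1 < n)%N ->
  (forall i j, (p <= i < c)%N -> (c <= j <= r)%N -> x i < x j) ->
  exists2 c', (p < c' <= r.+1)%N &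
    (forall i j, (p <= i < c')%N -> (c' <= j <= r.+1)%N -> x i < x j) \/
    (forall i j, (p <= i < c')%N -> (c' <= j <= r.+1)%N -> x j < x i).
Proof.
move=> xP xI pcr rn lr.
have xN i : (i <= r)%N -> x i != x r.+1.
  by move=> ir; apply/eqP=> /xI; rewrite !inE; lia.
(* [q] is the first position of the lower part whose entry exceeds [x r.+1], or [c] if there is
   none. *)
have [q qP qmin] : exists2 q, (p <= q <= c)%N && ((q == c) || (x r.+1 < x q)) &
    forall i, (p <= i < q)%N -> x i < x r.+1.
  have ex : exists q, (p <= q <= c)%N && ((q == c) || (x r.+1 < x q)).
    by exists c; rewrite eqxx; lia.
  case: (ex_minnP ex) => q qP qmin; exists q => // i iq.
  have := qmin i; have := xN i; lia.
have [qc|qc] := eqVneq q c.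
  exists c; first lia.
  left=> i j ic jr; have [->|] := eqVneq j r.+1; first by apply: qmin; lia.
  by move=> jr1; apply: lr; lia.
have xq : x r.+1 < x q by lia.
have big i : (q <= i < c)%N -> x r.+1 < x i.
  move=> iqc; have [->//|iq] := eqVneq i q.
  (* An entry below [x r.+1] at [i] would make [q], [i], [r], [r.+1] an occurrence of 3142. *)
  have := xP q i r r.+1; have := lr q r; have := lr i r; have := xN i; lia.
have [qp|pq] := eqVneq q p.
  exists r.+1; first lia.
  right=> i j ir jr; have -> : j = r.+1 by lia.
  have [ic|ci] := ltnP i c; first by apply: big; lia.
  by have := lr q i; lia.
exists q; first lia.
left=> i j iq jr; have [->|jr1] := eqVneq j r.+1; first by apply: qmin; lia.
have [jc|cj] := ltnP j c; last by apply: lr; lia.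
by have := qmin i; have := big j; lia.
Qed.

(** Induction on [r]. A descending cut is an ascending one for [- x], and negation exchanges 2413
    and 3142. *)
Lemma interval_cut (x : nat -> int) (n p r : nat) :
  noninterlaced x n -> {in gtn n &, injective x} -> (p < r < n)%N ->
  exists2 c, (p < c <= r)%N &
    (forall i j, (p <= i < c)%N -> (c <= j <= r)%N -> x i < x j) \/
    (forall i j, (p <= i < c)%N -> (c <= j <= r)%N -> x j < x i).
Proof.
move=> xP xI; elim: r => [|r IHr] prn; first lia.
have [pr|rp] := ltnP p r; last first.
  have -> : p = r by lia.
  exists r.+1; first lia.
  have [lt|] := ltP (x r) (x r.+1).
    left=> i j ir jr; have -> : i = r by lia.
    by have -> : j = r.+1 by lia.
  rewrite le_eqVlt => /orP[/eqP/xI|lt]; first by rewrite !inE; lia.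
  right=> i j ir jr; have -> : i = r by lia.
  by have -> : j = r.+1 by lia.
have [|c pcr [lr|lr]] := IHr; first lia.
  by apply: (interval_cut_step xP xI pcr _ lr); lia.
have [||||c' c'r [lr'|lr']] :=
    @interval_cut_step (fun i => - x i) n p c r (noninterlacedN xP).
- by move=> i j ? ? /oppr_inj; apply: xI.
- by [].
- by lia.
- by move=> i j ic jr; have := lr i j ic jr; lia.
- exists c' => //; right=> i j ic jr; have := lr' i j ic jr; lia.
- exists c' => //; left=> i j ic jr; have := lr' i j ic jr; lia.
Qed.

(** The scheme of [interval_cut_step] in absolute values, with a positive upper part. A negative new
    entry dominates the upper part by [mixed_increasing], hence the whole prefix, and is cut off
    alone; a positive one is compared with the lower part as before. *)
Lemma signed_prefix_cut_step (x : nat -> int) (n c r : nat) :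
  noninterlaced x n -> mixed_increasing x n ->
  (forall i, (i < n)%N -> x i != 0) ->
  {in gtn n &, injective (fun i => `|x i|)} ->
  (c <= r)%N -> (r.+1 < n)%N ->
  (forall i j, (i < c)%N -> (c <= j <= r)%N -> `|x i| < x j) ->
  (forall j, (c <= j <= r)%N -> 0 < x j) ->
  exists2 c', (c' <= r.+1)%N &
    (forall i j, (i < c')%N -> (c' <= j <= r.+1)%N -> `|x i| < `|x j|) /\
    ((forall j, (c' <= j <= r.+1)%N -> 0 < x j) \/
     (forall j, (c' <= j <= r.+1)%N -> x j < 0)).
Proof.
move=> xP xM x0 xI cr rn lr pos.
have xN i : (i <= r)%N -> `|x i| != `|x r.+1|.
  by move=> ir; apply/eqP=> /(xI i r.+1); rewrite !inE; lia.
have [q qP qmin] : exists2 q, (q <= c)%N && ((q == c) || (`|x r.+1| < `|x q|)) &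
    forall i, (i < q)%N -> `|x i| < `|x r.+1|.
  have ex : exists q, (q <= c)%N && ((q == c) || (`|x r.+1| < `|x q|)).
    by exists c; rewrite eqxx; lia.
  case: (ex_minnP ex) => q qP qmin; exists q => // i iq.
  have := qmin i; have := xN i; lia.
have y0 := x0 r.+1.
have [yneg|ypos] := ltP (x r.+1) 0.
  have rpos := pos r.
  have big j : (c <= j <= r)%N -> `|x j| < `|x r.+1|.
    by move=> jr; have := xM j r.+1; have := pos j jr; lia.
  (* Otherwise [|x r.+1| < |x q| < x r], against [big r]. *)
  have qc : q = c.
    by have := lr q r; have := big r; lia.
  exists r.+1; first lia.
  split; last by right=> j jr; have -> : j = r.+1 by lia.
  move=> i j ir jr; have -> : j = r.+1 by lia.
  by have [ic|ci] := ltnP i c; [apply: qmin; lia | apply: big; lia].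
have [qc|qc] := eqVneq q c.
  exists c; first lia.
  split=> [i j ic jr|].
    have [->|jr1] := eqVneq j r.+1; first by apply: qmin; lia.
    by have := lr i j; lia.
  left=> j jr; have [->|jr1] := eqVneq j r.+1; first lia.
  by apply: pos; lia.
have xq : `|x r.+1| < `|x q| by lia.
have bigpos i : (i < c)%N -> `|x r.+1| < `|x i| -> 0 < x i.
  by move=> ic yi; have := xM i r.+1; have := x0 i; lia.
have big i : (q <= i < c)%N -> `|x r.+1| < `|x i|.
  move=> iqc; have [->//|iq] := eqVneq i q.
  have qpos := bigpos q.
  (* A negative [x i] comes after the positive [x q], so its absolute value is even larger; a
     positive one below [x r.+1] would complete a 3142 at [q], [i], [r], [r.+1]. *)
  have [] := ltP (x i) 0.
    by have := xM q i; have := xN i; lia.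
  have := xP q i r r.+1; have := lr q r; have := lr i r; have := xN i; lia.
exists q; first lia.
split=> [i j iq jr|].
  have [->|jr1] := eqVneq j r.+1; first by apply: qmin.
  have [jc|cj] := ltnP j c; last by have := lr i j; lia.
  by have := qmin i; have := big j; lia.
left=> j jr; have [->|jr1] := eqVneq j r.+1; first lia.
have [jc|cj] := ltnP j c; last by apply: pos; lia.
by apply: bigpos => //; apply: big; lia.
Qed.

(** The value [c = 0] stands for a prefix of constant sign, which starts the induction. A negative
    upper part becomes positive under negation of [x]. *)
Lemma signed_prefix_cut (x : nat -> int) (n r : nat) :
  noninterlaced x n -> mixed_increasing x n ->
  (forall i, (i < n)%N -> x i != 0) ->
  {in gtn n &, injective (fun i => `|x i|)} -> (r < n)%N ->
  exists2 c, (c <= r)%N &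
    (forall i j, (i < c)%N -> (c <= j <= r)%N -> `|x i| < `|x j|) /\
    ((forall j, (c <= j <= r)%N -> 0 < x j) \/
     (forall j, (c <= j <= r)%N -> x j < 0)).
Proof.
move=> xP xM x0 xI; elim: r => [|r IHr] rn.
  exists 0%N => //; split=> [i j|]; first lia.
  have [lt|ge] := ltP (x 0%N) 0; first by right=> j j0; have -> : j = 0%N by lia.
  by left=> j j0; have -> : j = 0%N; have := x0 0%N rn; lia.
have [|c cr [lr [pos|neg]]] := IHr; first lia.
  apply: (signed_prefix_cut_step xP xM x0 xI cr rn) => // i j ic jr.
  by rewrite -[x j]gtr0_norm ?pos ?lr.
have [|||||||c' c'r [lr' [pos'|neg']]] :=
    @signed_prefix_cut_step (fun i => - x i) n c r (noninterlacedN xP).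
- by move=> i j ij; rewrite !normrN; have := xM i j ij; have := x0 i; have := x0 j; lia.
- by move=> i ilt; have := x0 i; lia.
- by move=> i j ? ? /=; rewrite !normrN; apply: xI.
- by [].
- by [].
- by move=> i j ic jr; have := lr i j; have := neg j; lia.
- by move=> j jr; have := neg j; lia.
- exists c' => //; split=> [i j ic jr|]; first by have := lr' i j; lia.
  by right=> j jr; have := pos' j; lia.
- exists c' => //; split=> [i j ic jr|]; first by have := lr' i j; lia.
  by left=> j jr; have := neg' j; lia.
Qed.

(** * Dot product and reflections *)

Section Dot.

Variables (R : realFieldType) (n : nat).
Local Notation V := 'cV[R]_n.
Implicit Types (a b c : V).

Lemma dotC a b : dot a b = dot b a.
Proof. by apply: eq_bigr => i _; rewrite mulrC. Qed.

Lemma dotDr a b c : dot a (b + c) = dot a b + dot a c.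
Proof. by rewrite -big_split; apply: eq_bigr => i _; rewrite mxE mulrDr. Qed.

Lemma dotZr k a b : dot a (k *: b) = k * dot a b.
Proof. by rewrite mulr_sumr; apply: eq_bigr => i _; rewrite mxE mulrCA. Qed.

Lemma dotNr a b : dot a (- b) = - dot a b.
Proof. by rewrite -scaleN1r dotZr mulN1r. Qed.

Lemma dot0r a : dot a 0 = 0.
Proof. by rewrite -(scale0r 0) dotZr mul0r. Qed.

Lemma dotDl a b c : dot (a + b) c = dot a c + dot b c.
Proof. by rewrite dotC dotDr ![dot c _]dotC. Qed.

Lemma dotNl a b : dot (- a) b = - dot a b.
Proof. by rewrite dotC dotNr dotC. Qed.

Lemma dot_sumr I (r : seq I) (P : pred I) (F : I -> V) a :
  dot a (\sum_(i <- r | P i) F i) = \sum_(i <- r | P i) dot a (F i).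
Proof. exact: (big_morph _ (dotDr a) (dot0r a)). Qed.

Lemma dot_eq0 a : dot a a = 0 -> a = 0.
Proof.
move/eqP; rewrite psumr_eq0 => [/allP a0|i _]; last exact: sqr_ge0.
apply/matrixP=> i j; rewrite ord1 mxE.
by have := a0 i (mem_index_enum i); rewrite mulf_eq0 orbb => /eqP.
Qed.

Lemma dot_span a (X : seq V) b :
  (forall x, x \in X -> dot a x = 0) -> b \in <<X>>%VS -> dot a b = 0.
Proof.
move=> aX; rewrite -[X]/(tval (in_tuple X)) => /coord_span ->.
rewrite dot_sumr big1 // => i _.
by rewrite dotZr aX ?mulr0 //= mem_nth.
Qed.

Lemma reflectionE a b : reflection a *m b = b - (2%:R / dot a a * dot a b) *: a.
Proof.
rewrite mulmxBl mul1mx -scalemxAl -mulmxA -scalerA; congr (_ - _ *: _).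
apply/matrixP=> i j; rewrite ord1 !mxE big_ord1 !mxE mulrC; congr (_ * _).
by apply: eq_bigr => k _; rewrite mxE.
Qed.

End Dot.

(** * Coefficients on the simple roots *)

Section Coefficients.

Variables (R : realFieldType) (n : nat).
Local Notation V := 'cV[R]_n.
Local Notation bv := (@basis_vec R n).
Local Notation e i := (basis_vec R (false, i)).
Implicit Types (v b : V) (x y : letter n) (i j : 'I_n) (c : nat).

(** One formula for both kinds of simple roots: [e c - e c.-1] for positive [c], and [e 0] for
    [c = 0], because no successor equals 0. *)
Definition alpha (c : 'I_n) : V := \col_i ((i == c)%:R - (i.+1 == c)%:R).

(* The coefficient of [alpha c] in [v] for [c < n]; it vanishes for [c >= n]. *)
Definition rcoef (c : nat) v : R := \sum_(i < n | (c <= i)%N) v i 0.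

Definition height v : R := \sum_(c < n) rcoef c v.

Lemma rcoefD c v b : rcoef c (v + b) = rcoef c v + rcoef c b.
Proof. by rewrite -big_split; apply: eq_bigr => i _; rewrite mxE. Qed.

Lemma rcoefZ c k v : rcoef c (k *: v) = k * rcoef c v.
Proof. by rewrite mulr_sumr; apply: eq_bigr => i _; rewrite mxE. Qed.

Lemma rcoefN c v : rcoef c (- v) = - rcoef c v.
Proof. by rewrite -scaleN1r rcoefZ mulN1r. Qed.

Lemma rcoefB c v b : rcoef c (v - b) = rcoef c v - rcoef c b.
Proof. by rewrite rcoefD rcoefN. Qed.

Lemma rcoef0 c : rcoef c 0 = 0.
Proof. by rewrite -(scale0r 0) rcoefZ mul0r. Qed.

Lemma rcoef_sum c I (r : seq I) (P : pred I) (F : I -> V) :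
  rcoef c (\sum_(i <- r | P i) F i) = \sum_(i <- r | P i) rcoef c (F i).
Proof. exact: (big_morph _ (rcoefD c) (rcoef0 c)). Qed.

Lemma heightD v b : height (v + b) = height v + height b.
Proof. by rewrite -big_split; apply: eq_bigr => i _; rewrite rcoefD. Qed.

Lemma heightZ k v : height (k *: v) = k * height v.
Proof. by rewrite mulr_sumr; apply: eq_bigr => i _; rewrite rcoefZ. Qed.

Lemma heightN v : height (- v) = - height v.
Proof. by rewrite -scaleN1r heightZ mulN1r. Qed.

Lemma height0 : height 0 = 0.
Proof. by rewrite -(scale0r 0) heightZ mul0r. Qed.

Lemma height_sum I (r : seq I) (P : pred I) (F : I -> V) :
  height (\sum_(i <- r | P i) F i) = \sum_(i <- r | P i) height (F i).
Proof. exact: (big_morph _ heightD height0). Qed.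

Lemma rcoefS i v : rcoef i v = v i 0 + rcoef i.+1 v.
Proof.
rewrite /rcoef (bigD1 i) //=; congr (_ + _).
by apply: eq_bigl => j; rewrite -val_eqE /=; lia.
Qed.

Lemma alphaE (c i : 'I_n) : alpha c i 0 = (i == c)%:R - (i.+1 == c)%:R.
Proof. by rewrite mxE. Qed.

Lemma sum_delta (f : nat -> R) (k m : nat) :
  \sum_(i < m) f i * (i == k :> nat)%:R = f k * (k < m)%:R.
Proof.
have [km|mk] := ltnP k m; last first.
  rewrite mulr0 big1 // => i _; case: eqVneq => [ik|_]; last by rewrite mulr0.
  by have := ltn_ord i; lia.
rewrite (bigD1 (Ordinal km)) //= eqxx big1 ?addr0 // => i.
by rewrite -val_eqE /= => /negPf ->; rewrite mulr0.
Qed.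

Lemma rcoef_alpha (c d : 'I_n) : rcoef d (alpha c) = (c == d)%:R.
Proof.
have -> : rcoef d (alpha c) = \sum_(i < n) (d <= i)%:R * (i == c :> nat)%:R -
    \sum_(i < n) (d <= i)%:R * (i.+1 == c)%:R.
  rewrite -sumrB /rcoef big_mkcond; apply: eq_bigr => i _; rewrite -mulrBr alphaE.
  by case: ifP => _; rewrite ?mul1r ?mul0r.
rewrite (sum_delta (fun k : nat => (d <= k)%:R)) ltn_ord mulr1.
have -> : \sum_(i < n) (d <= i)%:R * (i.+1 == c)%:R = (d < c)%:R :> R.
  case: c => -[|c] cn /=; first by rewrite big1 // => i _; rewrite mulr0.
  by under eq_bigr do rewrite eqSS;
    rewrite (sum_delta (fun k : nat => (d <= k)%:R)) (ltnW cn) mulr1.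
by rewrite -val_eqE /=; case: ltngtP => _; rewrite ?subrr ?subr0.
Qed.

Lemma rcoef_ge c v : (n <= c)%N -> rcoef c v = 0.
Proof. by move=> nc; rewrite /rcoef big_pred0 // => i; have := ltn_ord i; lia. Qed.

(** Summation by parts: [v i 0] is [rcoef i v - rcoef i.+1 v]. *)
Lemma sum_rcoef_alpha v : v = \sum_(c < n) rcoef c v *: alpha c.
Proof.
apply/matrixP=> i j; rewrite ord1 summxE {j}.
under eq_bigr do rewrite mxE alphaE mulrBr [i == _]eq_sym [i.+1 == _]eq_sym.
rewrite sumrB !(sum_delta (fun k => rcoef k v)) ltn_ord mulr1 rcoefS.
(* At the last index there is no simple root [i.+1], in agreement with [rcoef n v = 0]. *)
by case: ltnP => [_|/rcoef_ge ->]; rewrite ?mulr1 ?addrK ?mul0r ?subr0 ?addr0.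
Qed.

Lemma basis_vecE x i : bv x i 0 = (-1) ^+ x.1 * (i == x.2)%:R.
Proof. by rewrite !mxE eqxx andbT. Qed.

Lemma rcoef_basis_vec c x : rcoef c (bv x) = (-1) ^+ x.1 * (c <= x.2)%:R.
Proof.
rewrite /rcoef; under eq_bigr do rewrite basis_vecE.
rewrite -mulr_sumr; congr (_ * _).
rewrite big_mkcond (bigD1 x.2) //= eqxx big1 => [|i /negPf ->]; last by case: ifP.
by rewrite addr0; case: ifP.
Qed.

(** The bridge to one-line notation: [e i] has coefficient 1 on each [alpha c] with [c <= i], hence
    height [i.+1]. Signs and comparisons of entries thus become signs of heights. *)
Lemma height_basis_vec x : height (bv x) = (letter_val x)%:~R.
Proof.
rewrite /height; under eq_bigr do rewrite rcoef_basis_vec.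
rewrite -mulr_sumr /letter_val rmorphM /= rmorphXn /= rmorphN1.
congr (_ * _); rewrite -natr_sum -pmulrn; congr _%:R.
case: x => s [i ilt] /=; rewrite -(big_mkord xpredT (fun k => nat_of_bool (k <= i)%N)).
rewrite (big_cat_nat (n := i.+1)) //=.
rewrite [X in (_ + X)%N]big_nat [X in (_ + X)%N]big1 => [|k kn]; last first.
  by case/andP: kn; rewrite ltnNge => /negPf->.
rewrite addn0 big_nat (eq_bigr (fun=> 1%N)) => [|k ki]; last by have -> : (k <= i)%N by lia.
by rewrite -big_nat sum_nat_const_nat subn0 muln1.
Qed.

End Coefficients.

(** * The root system of type B *)

Section TypeB.

Variables (R : realFieldType) (n : nat).
Local Notation V := 'cV[R]_n.
Local Notation bv := (@basis_vec R n).
Local Notation e i := (basis_vec R (false, i)).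
Local Notation rootsB := (Defs.roots (typeB R n)).
Implicit Types (v b : V) (x y : letter n).

Lemma basis_vec_opp x : bv (letter_opp x) = - bv x.
Proof. by rewrite /basis_vec signrN scaleNr. Qed.

Lemma basis_vecN (i : 'I_n) : bv (true, i) = - e i.
Proof. exact: (basis_vec_opp (false, i)). Qed.

Lemma posBP b : reflect
  ((exists j, b = e j) \/ exists (i j : 'I_n) s, (i < j)%N /\ b = e j + bv (s, i))
  (b \in posB R n).
Proof.
rewrite /posB !mem_cat; apply: (iffP or3P).
- case=> [/mapP[j _ ->]|/allpairsPdep[i [j [_ + ->]]]|/allpairsPdep[i [j [_ + ->]]]].
  + by left; exists j.
  + by rewrite mem_filter => /andP[ij _]; right; exists i, j, false.
  + rewrite mem_filter => /andP[ij _]; right; exists i, j, true.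
    by rewrite basis_vecN.
- case=> [[j ->]|[i [j [[] [ij ->]]]]].
  + by apply: Or31; apply/mapP; exists j; rewrite ?mem_enum.
  + by apply: Or33; apply/allpairsPdep; exists i, j;
    rewrite mem_enum mem_filter mem_enum ij basis_vecN.
  + by apply: Or32; apply/allpairsPdep; exists i, j;
    rewrite mem_enum mem_filter mem_enum ij.
Qed.

Lemma rootsBE b : (b \in rootsB) = (b \in posB R n) || (- b \in posB R n).
Proof.
rewrite mem_cat; congr (_ || _).
by rewrite -[X in X \in map _ _]opprK mem_map //; apply: oppr_inj.
Qed.

Lemma rootsB_opp b : (- b \in rootsB) = (b \in rootsB).
Proof. by rewrite !rootsBE opprK orbC. Qed.

(** Written with letters, the roots are visibly stable under maps that permute the basis vectors up
    to sign. *)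
Lemma rootsBP b : reflect
  ((exists x, b = bv x) \/ exists x y, x.2 != y.2 /\ b = bv x + bv y)
  (b \in rootsB).
Proof.
have pos b' : b' \in posB R n ->
    (exists x, b' = bv x) \/ exists x y, x.2 != y.2 /\ b' = bv x + bv y.
  move=> /posBP[[j ->]|[i [j [s [ij ->]]]]]; first by left; exists (false, j).
  right; exists (false, j), (s, i); split=> //=.
  by apply: contraTneq ij => ->; rewrite ltnn.
apply: (iffP idP) => [|[[[s i] ->]|[[s i] [[t j] [/= ij ->]]]]].
- rewrite rootsBE => /orP[/pos //|/pos[[x bx]|[x [y [xy bxy]]]]].
    by left; exists (letter_opp x); rewrite basis_vec_opp -bx opprK.
  right; exists (letter_opp x), (letter_opp y); split=> //.
  by rewrite !basis_vec_opp -opprD -bxy opprK.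
- have ei : e i \in posB R n by apply/posBP; left; exists i.
  by rewrite rootsBE; case: s; rewrite ?basis_vecN ?opprK ei ?orbT.
- wlog ij' : s i t j ij / (i < j)%N => [th|].
    have [ltij|ltji|/val_inj eqij] := ltngtP i j; first exact: th.
      by rewrite addrC; apply: th; rewrite // eq_sym.
    by rewrite eqij eqxx in ij.
  have p s' : e j + bv (s', i) \in posB R n by apply/posBP; right; exists i, j, s'.
  rewrite rootsBE; case: t; last by rewrite addrC p.
  by rewrite basis_vecN opprB -(basis_vec_opp (s, i)) (p (~~ s)) orbT.
Qed.

Lemma ord_succ (c : 'I_n) : (0 < c)%N -> exists d : 'I_n, c = d.+1 :> nat.
Proof.
by move=> cpos; exists (Ordinal (leq_ltn_trans (leq_pred c) (ltn_ord c))); rewrite /= prednK.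
Qed.

Lemma alpha_basis_vec (c d : 'I_n) : c = d.+1 :> nat -> alpha R c = e c - e d.
Proof.
move=> cd; apply/matrixP=> i j; rewrite ord1 alphaE mxE [(- _ : V) _ _]mxE !basis_vecE.
by rewrite !mul1r cd eqSS.
Qed.

Lemma alpha0_basis_vec (c : 'I_n) : c = 0%N :> nat -> alpha R c = e c.
Proof.
by move=> c0; apply/matrixP=> i j; rewrite ord1 alphaE basis_vecE c0 subr0 mul1r.
Qed.

Lemma simpleBP b : reflect (exists c, b = alpha R c) (b \in simpleB R n).
Proof.
rewrite /simpleB mem_cat; apply: (iffP orP).
- case=> [/mapP[c]|/allpairsPdep[d [c [_ + ->]]]]; rewrite mem_filter.
    by move=> /andP[/eqP c0 _] ->; exists c; rewrite alpha0_basis_vec.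
  by move=> /andP[/eqP cd _]; exists c; rewrite (alpha_basis_vec cd).
- case=> c ->; case: (posnP c) => [c0|cpos].
    left; rewrite alpha0_basis_vec //; apply/mapP; exists c => //.
    by rewrite mem_filter /= c0 mem_enum.
  have [d cd] := ord_succ cpos.
  right; rewrite (alpha_basis_vec cd); apply/allpairsPdep; exists d, c.
  by rewrite mem_enum mem_filter mem_enum /= cd eqxx.
Qed.

Lemma e_inj : injective (fun i : 'I_n => e i).
Proof.
move=> i j /matrixP/(_ i 0); rewrite !basis_vecE !mul1r eqxx /=.
by case: eqP => // _ /eqP; rewrite oner_eq0.
Qed.

Lemma alpha_inj : injective (@alpha R n).
Proof.
move=> c d /(congr1 (rcoef c)); rewrite !rcoef_alpha eqxx.
by case: eqP => // _ /eqP; rewrite oner_eq0.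
Qed.

Lemma alpha_posB (c : 'I_n) : alpha R c \in posB R n.
Proof.
have /simpleBP : exists c', alpha R c = alpha R c' by exists c.
rewrite /simpleB mem_cat => /orP[/mapP[c' _ ->]|/allpairsPdep[d [c' [_ + ->]]]].
  by apply/posBP; left; exists c'.
rewrite mem_filter => /andP[/eqP cd _]; apply/posBP; right.
by exists d, c', true; rewrite basis_vecN cd ltnS.
Qed.

Lemma uniq_simpleB : uniq (simpleB R n).
Proof.
rewrite /simpleB cat_uniq map_inj_uniq; last exact: e_inj.
rewrite filter_uniq ?enum_uniq //=; apply/andP; split.
- apply/hasPn=> b /allpairsPdep[d [c [_ + ->]]]; rewrite mem_filter => /andP[/eqP cd _].
  rewrite -(alpha_basis_vec cd); apply/mapP=> -[c']; rewrite mem_filter.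
  move=> /andP[/eqP c0 _]; rewrite -(alpha0_basis_vec c0) => /alpha_inj cc.
  by rewrite cc c0 in cd.
- apply: allpairs_uniq_dep; rewrite ?enum_uniq //.
    by move=> i _; rewrite filter_uniq ?enum_uniq.
  move=> [i j] [i' j'] /allpairsPdep[i1 [j1 [_ + [-> ->]]]].
  rewrite mem_filter => /andP[/eqP ij _].
  move=> /allpairsPdep[i2 [j2 [_ + [-> ->]]]].
  rewrite mem_filter => /andP[/eqP ij' _] /=.
  rewrite -!alpha_basis_vec // => /alpha_inj jj; rewrite jj in ij *.
  by have -> : i1 = i2 by apply/val_inj/succn_inj; rewrite -ij -ij'.
Qed.

Lemma posB_rcoef b (c : nat) : b \in posB R n ->
  exists k : nat, rcoef c b = k%:R.
Proof.
move=> /posBP[[j ->]|[i [j [s [ij ->]]]]].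
  by exists (c <= j)%N; rewrite rcoef_basis_vec mul1r.
rewrite rcoefD !rcoef_basis_vec mul1r /=; case: s; last first.
  by exists ((c <= j) + (c <= i))%N; rewrite mul1r natrD.
exists ((c <= j) - (c <= i))%N; rewrite mulN1r natrB //.
by case: (leqP c i) => // ci; rewrite (leq_trans ci (ltnW ij)).
Qed.

Lemma posB_rcoef_ge0 b (c : nat) : b \in posB R n -> 0 <= rcoef c b.
Proof. by move=> /posB_rcoef-/(_ c)[k ->]; rewrite ler0n. Qed.

Lemma height_posB b : b \in posB R n -> 0 < height b.
Proof.
move=> /posBP[[j ->]|[i [j [s [ij ->]]]]]; rewrite ?heightD !height_basis_vec -?intrD.
  by rewrite ltr0z.
by rewrite ltr0z /letter_val; case: s; rewrite /= ?expr0 ?expr1; lia.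
Qed.

(** A linear form detects positivity, so whether [M] inverts [b] can be read off the sign of the
    height of [M *m b]. *)
Lemma posBE b : (b \in posB R n) = (b \in rootsB) && (0 < height b).
Proof.
apply/idP/andP=> [bpos|[]]; first by rewrite rootsBE bpos height_posB.
rewrite rootsBE => /orP[//|/height_posB]; rewrite heightN => ? ?; lra.
Qed.

Lemma height_rootsB b : b \in rootsB -> height b != 0.
Proof.
by rewrite rootsBE neq_lt => /orP[]/height_posB; rewrite ?heightN ?oppr_gt0 => ->; rewrite ?orbT.
Qed.

Lemma rootsB_neq0 b : b \in rootsB -> b != 0.
Proof. by move=> /height_rootsB; apply: contraNneq => ->; rewrite height0. Qed.

Lemma posB_opp b : b \in rootsB -> (- b \in posB R n) = (height b < 0).
Proof. by move=> br; rewrite posBE rootsB_opp br heightN oppr_gt0. Qed.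

(** The coefficients of a root never have opposite signs, so a single positive one decides. *)
Lemma rcoef_gt0_posB b (c : nat) : b \in rootsB -> 0 < rcoef c b -> b \in posB R n.
Proof.
rewrite rootsBE => /orP[//|/posB_rcoef_ge0-/(_ c)]; rewrite rcoefN => ? ?; lra.
Qed.

Lemma rootsB_letter_map (M : 'M[R]_n) (f : letter n -> letter n) :
  (forall x, M *m bv x = bv (f x)) ->
  (forall x y, x.2 != y.2 -> (f x).2 != (f y).2) ->
  forall b, b \in rootsB -> M *m b \in rootsB.
Proof.
move=> Mf f2 b /rootsBP[[x ->]|[x [y [xy ->]]]]; apply/rootsBP.
  by left; exists (f x).
by right; exists (f x), (f y); rewrite mulmxDr !Mf f2.
Qed.

(** Simple reflections act on letters: the one in [alpha 0] changes the sign of the first basis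
    vector, the one in [alpha d.+1] exchanges the indices [d] and [d.+1]. *)
Lemma reflection_alpha_rootsB (c : 'I_n) b :
  b \in rootsB -> reflection (alpha R c) *m b \in rootsB.
Proof.
have dotb a x : dot a (bv x) = (-1) ^+ x.1 * a x.2 0.
  rewrite /dot (bigD1 x.2) //= basis_vecE eqxx mulr1 big1 ?addr0 => [|i /negPf ix].
    by rewrite mulrC.
  by rewrite basis_vecE ix !mulr0.
have ndiag (i j : 'I_n) : i != j -> e i j 0 = 0 :> R.
  by move=> /negPf ij; rewrite basis_vecE eq_sym ij mulr0.
have diag (i : 'I_n) : e i i 0 = 1 :> R by rewrite basis_vecE eqxx mulr1.
have bvE x : bv x = (-1) ^+ x.1 *: e x.2 by case: x => s i; rewrite /basis_vec scale1r.
have [c0|cpos] := posnP c.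
  apply: (@rootsB_letter_map _ (fun x => (x.1 (+) (x.2 == c), x.2))) => // x.
  rewrite alpha0_basis_vec // reflectionE !dotb /= !mul1r diag divr1.
  rewrite [RHS]bvE [bv x]bvE /=.
  have [->|xc] := eqVneq x.2 c; last by rewrite addbF ndiag 1?eq_sym // !mulr0 scale0r subr0.
  by rewrite diag signr_addb expr1 -scalerBl; congr (_ *: _); ring.
have [d cd] := ord_succ cpos.
have ncd : c != d by rewrite -val_eqE /= cd; lia.
apply: (@rootsB_letter_map _ (fun x => (x.1, tperm c d x.2))) => [x|x y]; last first.
  by rewrite /= (inj_eq perm_inj).
have ac : alpha R c c 0 = 1.
  by rewrite alphaE eqxx gtn_eqF // subr0.
have ad : alpha R c d 0 = - 1.
  by rewrite alphaE eq_sym (negPf ncd) cd eqxx sub0r.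
have aa : dot (alpha R c) (alpha R c) = 2%:R.
  by rewrite {2}(alpha_basis_vec cd) dotDr dotNr !dotb /= ac ad; ring.
rewrite reflectionE aa dotb divff ?pnatr_eq0 // mul1r [RHS]bvE [bv x]bvE /=.
rewrite -scalerA -scalerBr; congr (_ *: _).
case: tpermP => [->|->|/eqP xc /eqP xd].
- by rewrite ac scale1r (alpha_basis_vec cd) opprB addrC subrK.
- by rewrite ad scaleN1r (alpha_basis_vec cd) opprK addrC subrK.
- rewrite (alpha_basis_vec cd) mxE [(- _ : V) _ _]mxE !ndiag 1?eq_sym // subr0.
  by rewrite scale0r subr0.
Qed.

End TypeB.

(** * Parabolic subsystems *)

Section Parabolic.

Variables (R : realFieldType) (n : nat).
Local Notation V := 'cV[R]_n.
Local Notation bv := (@basis_vec R n).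
Local Notation e i := (basis_vec R (false, i)).
Local Notation rootsB := (Defs.roots (typeB R n)).
Implicit Types (v b : V) (x y : letter n) (J : {set 'I_n}) (Phi : root_data R n).

Definition supported J b : bool :=
  [forall c : 'I_n, (c \notin J) ==> (rcoef c b == 0)].

Lemma supportedP J b :
  reflect (forall c : 'I_n, c \notin J -> rcoef c b = 0) (supported J b).
Proof. by apply: (iffP forall_inP) => bJ c /bJ/eqP. Qed.

(** Lists are compared by membership, as their order carries no meaning; uniqueness of the simple
    roots turns the sum in [root_le] into a sum over [J]. *)
Definition parabolic Phi J : Prop :=
  [/\ Defs.roots Phi =i [pred b in rootsB | supported J b],
      pos_roots Phi =i [pred b in posB R n | supported J b],
      simple_roots Phi =i [seq alpha R c | c in J] &
      uniq (simple_roots Phi)].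

Lemma supported_setT b : supported setT b.
Proof. by apply/supportedP=> c; rewrite inE. Qed.

Lemma supported_alpha J (c : 'I_n) : supported J (alpha R c) = (c \in J).
Proof.
apply/supportedP/idP => [cJ|cJ d dJ].
  by apply: contraT => /cJ; rewrite rcoef_alpha eqxx => /eqP; rewrite oner_eq0.
by rewrite rcoef_alpha; case: eqP dJ => // <-; rewrite cJ.
Qed.

Lemma supported_sum J b :
  supported J b -> b = \sum_(c in J) rcoef c b *: alpha R c.
Proof.
move=> /supportedP bJ; rewrite {1}[b]sum_rcoef_alpha (bigID (mem J)) /=.
by rewrite [X in _ + X]big1 ?addr0 // => c cJ; rewrite bJ ?scale0r.
Qed.

Lemma rcoef_lincomb J (f : 'I_n -> R) (d : 'I_n) :
  rcoef d (\sum_(c in J) f c *: alpha R c) = if d \in J then f d else 0.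
Proof.
rewrite rcoef_sum (eq_bigr (fun c => f c * (c == d)%:R)); last first.
  by move=> c _; rewrite rcoefZ rcoef_alpha.
case: ifP => dJ.
  rewrite (bigD1 d) //= eqxx mulr1 big1 ?addr0 // => c /andP[_ /negPf ->].
  by rewrite mulr0.
by rewrite big1 // => c; case: eqVneq => [->|]; rewrite ?dJ ?mulr0.
Qed.

Lemma parabolic_typeB : parabolic (typeB R n) setT.
Proof.
split=> [b|b|b|]; rewrite ?inE ?supported_setT ?andbT //; last exact: uniq_simpleB.
by apply/simpleBP/imageP => -[c]; [move=> ->; exists c | move=> _ ->; exists c].
Qed.

Section Properties.

Variables (Phi : root_data R n) (J : {set 'I_n}).
Hypothesis PhiJ : parabolic Phi J.

Lemma parabolic_roots b : (b \in Defs.roots Phi) = (b \in rootsB) && supported J b.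
Proof. by case: PhiJ => -> _ _ _; rewrite inE. Qed.

Lemma parabolic_pos b : (b \in pos_roots Phi) = (b \in posB R n) && supported J b.
Proof. by case: PhiJ => _ -> _ _; rewrite inE. Qed.

Lemma parabolic_posE b :
  (b \in pos_roots Phi) = (b \in Defs.roots Phi) && (0 < height b).
Proof. by rewrite parabolic_pos parabolic_roots posBE andbAC. Qed.

Lemma parabolic_pos_roots b : b \in pos_roots Phi -> b \in Defs.roots Phi.
Proof. by rewrite parabolic_posE => /andP[]. Qed.

Lemma parabolic_roots_opp b : (- b \in Defs.roots Phi) = (b \in Defs.roots Phi).
Proof.
rewrite !parabolic_roots rootsB_opp; congr (_ && _).
by apply: eq_forallb => c; rewrite rcoefN oppr_eq0.
Qed.

Lemma parabolic_neq0 b : b \in Defs.roots Phi -> b != 0.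
Proof. by rewrite parabolic_roots => /andP[/rootsB_neq0]. Qed.

Lemma parabolic_pos_opp b :
  b \in Defs.roots Phi -> (- b \in pos_roots Phi) = (height b < 0).
Proof. by move=> br; rewrite parabolic_posE parabolic_roots_opp br heightN oppr_gt0. Qed.

Lemma parabolic_height b : b \in Defs.roots Phi -> height b != 0.
Proof. by rewrite parabolic_roots => /andP[/height_rootsB]. Qed.

Lemma parabolic_pos_rcoef_ge0 b c : b \in pos_roots Phi -> 0 <= rcoef c b.
Proof. by rewrite parabolic_pos => /andP[/posB_rcoef_ge0]. Qed.

Lemma parabolic_simpleP b :
  reflect (exists2 c, c \in J & b = alpha R c) (b \in simple_roots Phi).
Proof. by case: PhiJ => _ _ -> _; apply: imageP. Qed.

Lemma parabolic_alpha (c : 'I_n) : (alpha R c \in simple_roots Phi) = (c \in J).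
Proof.
by apply/parabolic_simpleP/idP => [[d dJ /alpha_inj ->] //|cJ]; exists c.
Qed.

Lemma parabolic_alpha_pos (c : 'I_n) : (alpha R c \in pos_roots Phi) = (c \in J).
Proof. by rewrite parabolic_pos alpha_posB supported_alpha. Qed.

Lemma parabolic_sum b :
  b \in Defs.roots Phi -> b = \sum_(c in J) rcoef c b *: alpha R c.
Proof. by rewrite parabolic_roots => /andP[_ /supported_sum]. Qed.

Lemma sum_simple (F : V -> V) :
  \sum_(d <- simple_roots Phi) F d = \sum_(c in J) F (alpha R c).
Proof.
case: PhiJ => _ _ sE su; rewrite -[RHS]big_image /=; apply: perm_big.
by apply: uniq_perm => //; rewrite map_inj_uniq ?enum_uniq //; apply: alpha_inj.
Qed.

Lemma root_leP (c : 'I_n) b : c \in J -> b \in pos_roots Phi ->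
  root_le Phi (alpha R c) b <-> 0 < rcoef c b.
Proof.
move=> cJ bpos; split=> [[f]|bc].
  rewrite sum_simple => /(congr1 (rcoef c)).
  under eq_bigr do rewrite -scaler_nat.
  rewrite (rcoef_lincomb _ (fun d => (f (alpha R d))%:R)) cJ rcoefB rcoef_alpha eqxx mulr1n.
  by have := ler0n R (f (alpha R c)); lra.
have /fin_all_exists[k kE] (d : 'I_n) : exists k : nat, rcoef d b = k%:R.
  by move: bpos; rewrite parabolic_pos => /andP[/posB_rcoef].
(* [root_le] wants coefficients as a function on vectors: each vector gets the sum over the indices
   [d] with [alpha d] equal to it, and there is at most one. *)
pose f v := (\sum_(d < n | alpha R d == v) (k d - (d == c)))%N.
have fE (d : 'I_n) : f (alpha R d) = (k d - (d == c))%N.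
  by rewrite /f (big_pred1 d) // => d'; rewrite (inj_eq (@alpha_inj R n)).
exists f; rewrite sum_simple.
rewrite {1}[b]parabolic_sum ?parabolic_pos_roots // (bigD1 c) //= [RHS](bigD1 c) //=.
rewrite fE eqxx addrAC -[X in _ - X]scale1r -scalerBl; congr (_ + _).
  by rewrite -scaler_nat natrB ?kE // -(ltr0n R) -kE.
by apply: eq_bigr => d /andP[_ /negPf dc]; rewrite fE dc subn0 kE scaler_nat.
Qed.

(** A common criterion for the subspaces left by a pivot and for the components of a decomposition;
    [U] need only be known on roots. *)
Lemma parabolic_subsystem (U : {vspace V}) (J' : {set 'I_n}) :
  J' \subset J -> (forall b, b \in Defs.roots Phi -> (b \in U) = supported J' b) ->
  parabolic (subsystem Phi U) J'.
Proof.
move=> /subsetP J'J UJ'; have sub b : supported J' b -> supported J b.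
  by move=> /supportedP bJ'; apply/supportedP => c cJ; apply: bJ'; apply: contra cJ => /J'J.
split=> [b|b|b|]; rewrite ?inE ?mem_filter.
- rewrite andbC parabolic_roots; apply/andP/andP=> [[/andP[br bJ] bU]|[br bJ]].
    by rewrite br -UJ' ?parabolic_roots ?br.
  by rewrite br sub // UJ' // parabolic_roots br sub.
- rewrite andbC parabolic_pos; apply/andP/andP=> [[/andP[br bJ] bU]|[br bJ]].
    by rewrite br -UJ' ?parabolic_pos_roots ?parabolic_pos ?br.
  by rewrite br sub // UJ' // parabolic_pos_roots // parabolic_pos br sub.
- apply/andP/imageP=> [[bU /parabolic_simpleP[c cJ bc]]|[c cJ' ->]].
    exists c => //; rewrite -(supported_alpha J') -bc -UJ' // bc.
    by rewrite parabolic_pos_roots ?parabolic_alpha_pos.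
  rewrite parabolic_alpha J'J // UJ' ?supported_alpha //.
  by rewrite parabolic_pos_roots // parabolic_alpha_pos J'J.
- by apply: filter_uniq; case: PhiJ.
Qed.

(** The forms [rcoef] are dual to the simple roots, so a span of simple roots is cut out by the
    vanishing of the other coefficients. *)
Lemma span_minusE (c : 'I_n) b :
  (b \in span_minus Phi (alpha R c)) = supported (J :\ c) b.
Proof.
apply/idP/idP => [|bJ].
  rewrite /span_minus; set X := [seq _ <- _ | _].
  rewrite -[X]/(tval (in_tuple X)) => /coord_span ->.
  apply/supportedP=> d; rewrite !inE negb_and negbK => dJ.
  rewrite rcoef_sum big1 // => i _; rewrite rcoefZ.
  have : (in_tuple X)`_i \in X by rewrite mem_nth.
  rewrite mem_filter => /andP[xc /parabolic_simpleP[d' d'J xE]].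
  move: xc; rewrite xE rcoef_alpha (inj_eq (@alpha_inj R n)) => d'c.
  case: eqVneq => [dd|_]; last by rewrite mulr0.
  by move: dJ; rewrite -dd d'J (negPf d'c).
rewrite [b](supported_sum bJ); apply: memv_suml => d.
rewrite !inE => /andP[dc dJ]; apply/memvZ/memv_span.
by rewrite mem_filter (inj_eq (@alpha_inj R n)) dc parabolic_alpha.
Qed.

Lemma parabolic_span_minus (c : 'I_n) : c \in J ->
  parabolic (subsystem Phi (span_minus Phi (alpha R c))) (J :\ c).
Proof.
move=> cJ; apply: parabolic_subsystem => [|b _]; first exact: subD1set.
exact: span_minusE.
Qed.

Lemma decomposition_roots k (U : 'I_k -> {vspace V}) i b v :
  decomposition Phi U -> b \in Defs.roots Phi -> v \in Defs.roots Phi ->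
  dot b v != 0 -> b \in U i -> v \in U i.
Proof.
move=> [_ _ Ucov Uorth] br vr bv0 bU; have [j vU] := Ucov _ vr.
have [->//|ij] := eqVneq i j; apply: contra_neqT bv0 => _.
by apply: (Uorth i j); rewrite // mem_filter ?bU ?vU.
Qed.

(** Split a root of [U i] into its part on the simple roots in [U i] and a remainder [z]. Then [z]
    lies in [U i] by subtraction, and is orthogonal to [U i] since a simple root outside [U i] is
    orthogonal to every root inside. Hence [z = 0]. *)
Lemma parabolic_decomposition k (U : 'I_k -> {vspace V}) i :
  decomposition Phi U ->
  parabolic (subsystem Phi (U i)) [set c in J | alpha R c \in U i].
Proof.
move=> dec; case: (dec) => Uspan _ Ucov Uorth.
apply: parabolic_subsystem => [|b br]; first by apply/subsetP=> c; rewrite inE => /andP[].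
set J' := finset _.
have inU (f : 'I_n -> R) : \sum_(c in J') f c *: alpha R c \in U i.
  by apply: memv_suml => c; rewrite inE => /andP[_ cU]; apply: memvZ.
apply/idP/idP=> [bU|/supported_sum ->]; last exact: inU.
pose z := \sum_(c in J :\: J') rcoef c b *: alpha R c.
have bE : b = \sum_(c in J') rcoef c b *: alpha R c + z.
  rewrite {1}(parabolic_sum br) (big_setID J') /=; congr (_ + _).
  by apply: eq_bigl => c; rewrite !inE; case: (c \in J).
have zU : z \in U i.
  have -> : z = b - \sum_(c in J') rcoef c b *: alpha R c by rewrite {1}bE addrC addKr.
  by rewrite memvB ?inU.
have z0 : z = 0.
  apply: dot_eq0; move: (zU); rewrite {1}(Uspan i); apply: dot_span => x.
  rewrite mem_filter => /andP[xU xr]; rewrite dotC dot_sumr big1 // => c.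
  rewrite !inE => /andP[+ cJ]; rewrite cJ /= => cU.
  rewrite dotZr; apply/eqP; rewrite mulf_eq0; apply/orP; right.
  apply: contraNT cU => xc; apply: (decomposition_roots dec xr _ xc xU).
  by rewrite parabolic_pos_roots // parabolic_alpha_pos.
apply/supportedP=> c cJ'; rewrite bE z0 addr0 rcoef_lincomb.
by rewrite (negPf cJ').
Qed.

End Properties.

End Parabolic.

(** * Inversion sets of separable elements *)

Section InterlaceFree.

Variables (R : realFieldType) (n : nat).
Local Notation V := 'cV[R]_n.
Local Notation bv := (@basis_vec R n).
Local Notation e i := (basis_vec R (false, i)).
Local Notation rootsB := (Defs.roots (typeB R n)).
Implicit Types (v b : V) (i j k l : 'I_n) (Phi : root_data R n).

(* For a signed permutation w this says that w_i and w_j of opposite signs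
   satisfy |w_i| < |w_j|, that is, the patterns -2 1 and 2 -1 are avoided. *)
Definition mixed_consistent Phi (I : pred V) : Prop :=
  forall i j, (i < j)%N ->
    {subset [:: e i; e j; e j - e i; e j + e i] <= pos_roots Phi} ->
    I (e i) != I (e j) -> I (e j + e i) = I (e j).

Definition order_pattern (I : pred V) i j k l : seq bool :=
  [:: I (e j - e i); I (e k - e i); I (e l - e i);
      I (e k - e j); I (e l - e j); I (e l - e k)].

Definition differences i j k l : seq V :=
  [:: e j - e i; e k - e i; e l - e i; e k - e j; e l - e j; e l - e k].

(* The two excluded inversion tables are those of 2413 and 3142. *)
Definition interlace_free Phi (I : pred V) : Prop :=
  forall i j k l, (i < j < k)%N -> (k < l)%N ->
    {subset differences i j k l <= pos_roots Phi} ->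
    order_pattern I i j k l \notin
      [:: [:: false; true; false; true; true; false];
          [:: true; false; true; false; false; true]].

Lemma dot_e i j : dot (e i) (e j) = (i == j)%:R.
Proof.
rewrite /dot (bigD1 j) //= !basis_vecE eqxx !mul1r mulr1 [j == i]eq_sym big1 ?addr0 //.
by move=> k /negPf kj; rewrite !basis_vecE kj !mulr0.
Qed.

(** Induction on separability. Both properties only concern configurations of positive roots of
    [Phi], so they pass up from a subsystem as soon as it contains the whole configuration. *)
Lemma separable_interlace_free Phi w : separable Phi w ->
  forall J, parabolic Phi J ->
  mixed_consistent Phi (mem (inversions Phi w)) /\
  interlace_free Phi (mem (inversions Phi w)).
Proof.
elim=> {w Phi} [Phi w Phi0|Phi w [a _ Phia]|Phi w k U w' _ dec res _ IH|
                Phi w a w' _ aS res _ IH cut] J PhiJ.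
- have none b : b \in pos_roots Phi -> False.
    by move/(parabolic_pos_roots PhiJ); rewrite Phi0.
  split=> [i j _ sub|i j k l _ _ sub].
    by case: (none (e i)); apply: sub; rewrite inE eqxx.
  by case: (none (e j - e i)); apply: sub; rewrite inE eqxx.
(* Type A_1 has a single positive root, while each configuration involves distinct ones. *)
- have one b b' : b \in pos_roots Phi -> b' \in pos_roots Phi -> b = b'.
    rewrite !(parabolic_posE PhiJ) !Phia !inE.
    by move=> /andP[/orP[]/eqP-> +] /andP[/orP[]/eqP-> +] //;
      rewrite heightN => ? ?; exfalso; lra.
  split=> [i j ij sub|i j k l ijk kl sub].
    have /e_inj eij : e i = e j by apply: one; apply: sub; rewrite !inE eqxx ?orbT.
    by move: ij; rewrite eij ltnn.
  have /addIr/e_inj ejk : e j - e i = e k - e i.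
    by apply: one; apply: sub; rewrite !inE eqxx ?orbT.
  by move: ijk; rewrite ejk ltnn andbF.
- have subU t b : b \in U t -> b \in pos_roots Phi -> b \in pos_roots (subsystem Phi (U t)).
    by rewrite mem_filter => -> ->.
  have inv t b : b \in U t ->
      (b \in inversions Phi w) = (b \in inversions (subsystem Phi (U t)) (w' t)).
    by move=> bU; case: (res t) => _ ->; rewrite [RHS]mem_filter bU.
  have conn t b v : b \in U t -> b \in pos_roots Phi -> v \in pos_roots Phi ->
      dot b v != 0 -> v \in U t.
    move=> bU /(parabolic_pos_roots PhiJ) br /(parabolic_pos_roots PhiJ) vr bv0.
    exact: (decomposition_roots dec br vr).
  have cov b : b \in pos_roots Phi -> exists t, b \in U t.
    by case: dec => _ _ Ucov _ bp; apply/Ucov/(parabolic_pos_roots PhiJ).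
  split=> [i j ij sub|i j k' l ijk kl sub].
    have [|t ejU] := cov (e j); first by apply: sub; rewrite !inE eqxx ?orbT.
    have ji : (j == i) = false by rewrite -val_eqE /=; lia.
    have subij b : b \in [:: e i; e j; e j - e i; e j + e i] -> b \in U t.
      (* Non-orthogonal roots share a component; [e i] and [e j + e i] follow by linearity. *)
      have diffU : e j - e i \in U t.
        apply: (conn t _ _ ejU); try by apply: sub; rewrite !inE eqxx ?orbT.
        by rewrite dotDr dotNr !dot_e eqxx ji subr0 oner_eq0.
      have eiU : e i \in U t by rewrite -[e i](subKr (e j)) memvB.
      by rewrite !inE => /or4P[]/eqP -> //; rewrite memvD.
    rewrite !inE !(inv t) ?subij ?inE ?eqxx ?orbT //.
    apply: (IH t _ (parabolic_decomposition PhiJ t dec)).1 => // b bs.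
    by apply: subU (subij _ bs) (sub _ bs).
  have [|t ijU] := cov (e j - e i); first by apply: sub; rewrite !inE eqxx ?orbT.
  have ne (x y : 'I_n) : (x < y)%N -> ((x == y) = false) * ((y == x) = false).
    by move=> xy; split; rewrite -val_eqE /=; lia.
  have lt : [/\ i < j, i < k', i < l, j < k' & j < l]%N by split; lia.
  case: lt => /ne nij /ne nik /ne nil /ne njk /ne njl.
  (* The roots [e k' - e i] and [e l - e i] are not orthogonal to [e j - e i], and the remaining
     differences are combinations of these three. *)
  have subij b : b \in differences i j k' l -> b \in U t.
    have ikU : e k' - e i \in U t.
      apply: (conn t _ _ ijU); try by apply: sub; rewrite !inE eqxx ?orbT.
      rewrite !(dotDl, dotNl, dotDr, dotNr) !dot_e !eqxx nij njk nik.
      by rewrite mulr1n mulr0n; apply/eqP; lra.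
    have ilU : e l - e i \in U t.
      apply: (conn t _ _ ijU); try by apply: sub; rewrite !inE eqxx ?orbT.
      rewrite !(dotDl, dotNl, dotDr, dotNr) !dot_e !eqxx nij njl nil.
      by rewrite mulr1n mulr0n; apply/eqP; lra.
    have shift (x y : 'I_n) : e x - e i \in U t -> e y - e i \in U t -> e y - e x \in U t.
      move=> xU yU; have -> : e y - e x = (e y - e i) - (e x - e i).
        by rewrite opprB addrA subrK.
      by rewrite memvB.
    rewrite !inE => /orP[/eqP-> //|/orP[/eqP-> //|/orP[/eqP-> //|]]].
    by move=> /or3P[]/eqP ->; apply: shift.
  have := (IH t _ (parabolic_decomposition PhiJ t dec)).2 i j k' l ijk kl.
  rewrite /order_pattern !inE !(inv t) ?subij ?inE ?eqxx ?orbT //; apply=> b bs.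
  by apply: subU (subij _ bs) (sub _ bs).
- have /(parabolic_simpleP PhiJ)[c cJ aE] := aS; subst a.
  set U := span_minus _ _ in res IH.
  have UE b : b \in pos_roots Phi -> (b \in U) = (rcoef c b == 0).
    rewrite (parabolic_pos PhiJ) (span_minusE PhiJ) => /andP[_ /supportedP bJ].
    apply/supportedP/eqP=> [|b0 d]; first by apply; rewrite !inE eqxx.
    by rewrite !inE negb_and negbK => /orP[/eqP->|/bJ].
  have subU b : b \in pos_roots Phi -> rcoef c b = 0 -> b \in pos_roots (subsystem Phi U).
    by move=> bp b0; rewrite mem_filter bp UE // b0 eqxx.
  have inv b : b \in pos_roots Phi -> rcoef c b = 0 ->
      (b \in inversions Phi w) = (b \in inversions (subsystem Phi U) w').
    by move=> bp b0; case: res => _ ->; rewrite [RHS]mem_filter UE // b0 eqxx.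
  (* [s] is the common status, inverted or not, of all positive roots above the pivot. *)
  have [s sE] : exists s, forall b, b \in pos_roots Phi -> 0 < rcoef c b ->
      (b \in inversions Phi w) = s.
    case: cut => cut; [exists true | exists false] => b bp b0; last apply: negbTE.
      by apply: cut => //; apply/(root_leP PhiJ cJ bp).
    by apply: cut => //; apply/(root_leP PhiJ cJ bp).
  have ge0 b : b \in pos_roots Phi -> 0 <= rcoef c b by apply: (parabolic_pos_rcoef_ge0 PhiJ).
  have [IHm IHi] := IH _ (parabolic_span_minus PhiJ cJ).
  split=> [i j ij sub|i j k l ijk kl sub].
    have eip : e i \in pos_roots Phi by apply: sub; rewrite !inE eqxx ?orbT.
    have ejp : e j \in pos_roots Phi by apply: sub; rewrite !inE eqxx ?orbT.
    have dp : e j - e i \in pos_roots Phi by apply: sub; rewrite !inE eqxx ?orbT.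
    have sp : e j + e i \in pos_roots Phi by apply: sub; rewrite !inE eqxx ?orbT.
    have := ge0 _ eip; have := ge0 _ ejp; have := ge0 _ dp; rewrite rcoefB => d0 j0 i0.
    (* If [e j] lies above the pivot, so does [e j + e i], and they share the status [s]. Otherwise
       all four roots have coefficient 0 at [c]. *)
    have [jpos|jneg] := ltP 0 (rcoef c (e j)).
      by move=> _; rewrite !inE !sE // rcoefD; lra.
    have c0 b : b \in [:: e i; e j; e j - e i; e j + e i] -> rcoef c b = 0.
      by rewrite !inE => /or4P[]/eqP ->; rewrite ?rcoefB ?rcoefD; lra.
    rewrite !inE !inv ?c0 ?inE ?eqxx ?orbT //; apply: IHm => // b bs.
    by apply: subU (sub _ bs) (c0 _ bs).
  have pij : e j - e i \in pos_roots Phi by apply: sub; rewrite !inE eqxx ?orbT.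
  have pik : e k - e i \in pos_roots Phi by apply: sub; rewrite !inE eqxx ?orbT.
  have pil : e l - e i \in pos_roots Phi by apply: sub; rewrite !inE eqxx ?orbT.
  have pjk : e k - e j \in pos_roots Phi by apply: sub; rewrite !inE eqxx ?orbT.
  have pjl : e l - e j \in pos_roots Phi by apply: sub; rewrite !inE eqxx ?orbT.
  have pkl : e l - e k \in pos_roots Phi by apply: sub; rewrite !inE eqxx ?orbT.
  have := ge0 _ pij; have := ge0 _ pjk; have := ge0 _ pkl.
  rewrite !rcoefB => gkl gjk gij; pose S := inversions Phi w.
  (* The [c]-th coefficient of [e] is nondecreasing along [i, j, k, l]. At its first jump, two
     differences across the jump share the status [s], while both excluded tables give them opposite
     values. Without a jump, induction applies. *)
  have [lt_ij|le_ij] := ltP (rcoef c (e i)) (rcoef c (e j)).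
    have Sij : (e j - e i \in S) = s by apply: sE; rewrite // rcoefB; lra.
    have Sik : (e k - e i \in S) = s by apply: sE; rewrite // rcoefB; lra.
    by rewrite /order_pattern !inE -/S Sij Sik !eqseq_cons; case: (s); rewrite ?andbF.
  have [lt_jk|le_jk] := ltP (rcoef c (e j)) (rcoef c (e k)).
    have Sik : (e k - e i \in S) = s by apply: sE; rewrite // rcoefB; lra.
    have Sil : (e l - e i \in S) = s by apply: sE; rewrite // rcoefB; lra.
    by rewrite /order_pattern !inE -/S Sil Sik !eqseq_cons; case: (s); rewrite ?andbF.
  have [lt_kl|le_kl] := ltP (rcoef c (e k)) (rcoef c (e l)).
    have Sil : (e l - e i \in S) = s by apply: sE; rewrite // rcoefB; lra.
    have Sjl : (e l - e j \in S) = s by apply: sE; rewrite // rcoefB; lra.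
    by rewrite /order_pattern !inE -/S Sil Sjl !eqseq_cons; case: (s); rewrite ?andbF.
  have c0 b : b \in differences i j k l -> rcoef c b = 0.
    rewrite !inE => /orP[/eqP->|/orP[/eqP->|/orP[/eqP->|/or3P[]/eqP->]]];
    by rewrite rcoefB; lra.
  have := IHi i j k l ijk kl.
  rewrite /order_pattern !inE !inv ?c0 ?inE ?eqxx ?orbT //; apply=> b bs.
  by apply: subU (sub _ bs) (c0 _ bs).
Qed.

End InterlaceFree.

(** * Restriction and decomposition *)

Section Restriction.

Variables (R : realFieldType) (n : nat).
Local Notation V := 'cV[R]_n.
Implicit Types (v b : V) (J : {set 'I_n}) (Phi : root_data R n).

Lemma reflection_self (a : V) : a != 0 -> reflection a *m a = - a.
Proof.
move=> a0; have aa : dot a a != 0 by apply: contra_neq a0 => /dot_eq0.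
by rewrite reflectionE divfK // -{1}[a]scale1r -scalerBl -scaleN1r; congr (_ *: _); ring.
Qed.

Lemma reflectionK (a b : V) : a != 0 -> reflection a *m (reflection a *m b) = b.
Proof.
move=> a0; rewrite [X in _ *m X]reflectionE mulmxBr -scalemxAr reflection_self // reflectionE.
by rewrite scalerN opprK subrK.
Qed.

(** Words in [weyl] grow on the left, but removing an inversion multiplies on the right. *)
Lemma weyl_mulr Phi a w :
  a \in Defs.roots Phi -> weyl Phi w -> weyl Phi (w *m reflection a).
Proof.
move=> ar; elim=> [|a' w' a'r _ IH]; last by rewrite -mulmxA; apply: weyl_refl.
by rewrite mul1mx -[reflection a]mulmx1; apply: weyl_refl => //; apply: weyl_id.
Qed.

Section Simple.

Variables (Phi : root_data R n) (J : {set 'I_n}) (c : 'I_n).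
Hypotheses (PhiJ : parabolic Phi J) (cJ : c \in J).
Local Notation a := (alpha R c).
Local Notation s := (reflection a).

Lemma alpha_roots : a \in Defs.roots Phi.
Proof. by rewrite (parabolic_pos_roots PhiJ) // (parabolic_alpha_pos PhiJ). Qed.

Lemma alpha_neq0 : a != 0.
Proof. exact: parabolic_neq0 PhiJ _ alpha_roots. Qed.

Lemma rcoef_reflection (d : 'I_n) b : d != c -> rcoef d (s *m b) = rcoef d b.
Proof.
move=> dc; rewrite reflectionE rcoefB rcoefZ rcoef_alpha eq_sym (negPf dc).
by rewrite mulr0 subr0.
Qed.

Lemma reflection_roots b : b \in Defs.roots Phi -> s *m b \in Defs.roots Phi.
Proof.
rewrite !(parabolic_roots PhiJ) => /andP[br /supportedP bJ].
rewrite reflection_alpha_rootsB //; apply/supportedP=> d dJ.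
by rewrite rcoef_reflection ?bJ //; apply: contraNneq dJ => ->.
Qed.

(** This bound excludes the multiples [k *: alpha c] with [k > 1], whose [c]-th entry is [k]. *)
Lemma rootsB_entry_le1 b (i : 'I_n) : b \in Defs.roots (typeB R n) -> b i 0 <= 1.
Proof.
have bve x : basis_vec R x i 0 <= (i == x.2)%:R.
  by rewrite basis_vecE; case: x.1; rewrite ?mul1r // mulN1r;
    case: (i == _); rewrite ?mulr1n ?mulr0n; lra.
move=> /rootsBP[[x ->]|[x [y [xy ->]]]].
  by apply: le_trans (bve x) _; case: (i == _); rewrite ?ler01.
rewrite mxE; apply: le_trans (lerD (bve x) (bve y)) _.
by rewrite -natrD lern1; case: eqVneq => [->|_]; rewrite ?(negPf xy) //; case: (_ == _).
Qed.

(** A positive root other than [alpha c] has a positive coefficient at some [d != c]; the reflection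
    leaves it unchanged, and it forces the image to be positive. *)
Lemma reflection_pos b : b \in pos_roots Phi -> b != a -> s *m b \in pos_roots Phi.
Proof.
move=> bp ba; have br := parabolic_pos_roots PhiJ bp.
have [d dc bd] : exists2 d : 'I_n, d != c & 0 < rcoef d b.
  apply: NNPP => no; move/negP: ba; apply; apply/eqP.
  have b0 (d : 'I_n) : d != c -> rcoef d b = 0.
    move=> dc; apply/eqP; rewrite eq_le (parabolic_pos_rcoef_ge0 PhiJ) // andbT leNgt.
    by apply/negP=> bd; apply: no; exists d.
  have bE : b = rcoef c b *: a.
    rewrite {1}[b]sum_rcoef_alpha (bigD1 c) //= big1 ?addr0 // => d dc.
    by rewrite b0 ?scale0r.
  have [k kE] : exists k : nat, rcoef c b = k%:R.
    by move: bp; rewrite (parabolic_pos PhiJ) => /andP[/posB_rcoef].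
  have := @rootsB_entry_le1 b c.
  move: br; rewrite (parabolic_roots PhiJ) => /andP[br _] /(_ br).
  rewrite {1}bE mxE alphaE eqxx gtn_eqF // subr0 mulr1 kE => k1.
  have := parabolic_neq0 PhiJ (parabolic_pos_roots PhiJ bp); rewrite bE kE.
  case: k k1 {kE} => [|[|k]]; rewrite ?scale0r ?eqxx ?scale1r //.
  by rewrite lern1.
have /reflection_roots := br; rewrite (parabolic_pos PhiJ) (parabolic_roots PhiJ).
move=> /andP[sr ->]; rewrite andbT; apply: (rcoef_gt0_posB (c := d)) => //.
by rewrite rcoef_reflection.
Qed.

End Simple.

(* If no simple root of Phi is inverted by w then no positive root is, and the
   identity works; otherwise replacing w by w s_a for an inverted simple root a
   removes exactly one inversion. *)
Lemma restriction_exists Phi J (w : 'M[R]_n) : parabolic Phi J ->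
  (forall b, b \in Defs.roots Phi -> height (w *m b) != 0) ->
  exists w', [/\ weyl Phi w',
    forall b, b \in Defs.roots Phi -> w' *m b \in Defs.roots Phi &
    forall b, b \in pos_roots Phi ->
      (- (w' *m b) \in pos_roots Phi) = (height (w *m b) < 0)].
Proof.
(* Inversions are counted without repetitions, since the list of positive roots may contain some. *)
move=> PhiJ; pose P := undup (pos_roots Phi).
have [m] := ubnP (count (fun b => height (w *m b) < 0) P).
elim: m w => // m IH w; rewrite ltnS => wm w0.
have [/exists_inP[c cJ wc]|/exists_inPn none] :=
  boolP [exists c in J, height (w *m alpha R c) < 0]; last first.
  exists 1%:M; split=> [|b|b bp]; rewrite ?mul1mx //; first exact: weyl_id.
  rewrite (parabolic_pos_opp PhiJ) ?(parabolic_pos_roots PhiJ) //.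
  have bh : 0 < height b by move: bp; rewrite (parabolic_posE PhiJ) => /andP[].
  rewrite ltNge (ltW bh); apply/esym/negbTE; rewrite -leNgt.
  rewrite (parabolic_sum PhiJ (parabolic_pos_roots PhiJ bp)) mulmx_sumr height_sum.
  apply: sumr_ge0 => c cJ; rewrite -scalemxAr heightZ mulr_ge0 //.
    exact: (parabolic_pos_rcoef_ge0 PhiJ).
  by rewrite leNgt none.
set a := alpha R c in wc; pose s := reflection a.
have a0 : a != 0 := alpha_neq0 PhiJ cJ.
have ap : a \in pos_roots Phi by rewrite (parabolic_alpha_pos PhiJ).
have sE b : (w *m s) *m b = w *m (s *m b) by rewrite mulmxA.
have sp b : b \in pos_roots Phi -> b != a -> s *m b \in pos_roots Phi.
  exact: (reflection_pos PhiJ cJ).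
have sa b : b \in pos_roots Phi -> s *m b != a.
  move=> bp; apply/eqP=> /(congr1 (mulmx s)); rewrite reflectionK // reflection_self //.
  move=> bE; move: bp; rewrite bE (parabolic_pos_opp PhiJ) ?(parabolic_pos_roots PhiJ) //.
  by move: ap; rewrite (parabolic_posE PhiJ) => /andP[_]; lra.
pose P' := [seq b <- P | b != a].
have perm : perm_eq P (a :: P').
  apply: uniq_perm; rewrite ?undup_uniq //= ?mem_filter ?eqxx ?filter_uniq ?undup_uniq //.
  move=> b; rewrite inE !mem_filter mem_undup.
  by have [->|] := eqVneq b a; rewrite ?ap.
(* The reflection permutes the positive roots other than [a], so only [a] changes the count. *)
have perm' : perm_eq P' (map (mulmx s) P').
  apply: uniq_perm; first by rewrite filter_uniq ?undup_uniq.
    by rewrite map_inj_uniq ?filter_uniq ?undup_uniq //; apply: can_inj (fun b => reflectionK b a0).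
  have P'E b : (b \in P') = (b != a) && (b \in pos_roots Phi).
    by rewrite mem_filter mem_undup.
  move=> b; apply/idP/mapP=> [|[b' + ->]]; rewrite P'E => /andP[ba bp].
    by exists (s *m b); rewrite ?reflectionK // P'E sp ?sa.
  by rewrite P'E sp ?sa.
have [||w' [w'W w'r w'I]] := IH (w *m s).
- apply: leq_trans _ wm; rewrite !(seq.permP perm) /= wc ltnS (seq.permP perm') count_map.
  rewrite sE reflection_self // mulmxN heightN oppr_lt0 ltNge ltW //= add0n.
  by apply/eq_leq/eq_count => b /=; rewrite sE reflectionK.
- by move=> b br; rewrite sE w0 // (reflection_roots PhiJ cJ).
have ar := parabolic_pos_roots PhiJ ap.
exists (w' *m s); split=> [|b br|b bp].
- exact: weyl_mulr.
- by rewrite -mulmxA w'r // (reflection_roots PhiJ cJ).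
- rewrite -mulmxA; have [->|ba] := eqVneq b a; last first.
    by rewrite w'I ?sp // sE reflectionK.
  (* Since [w] inverts [a], the product [w *m s] does not; so [w'] sends [a] to a root of
     nonnegative, hence positive, height. *)
  rewrite reflection_self // mulmxN opprK wc.
  have := w'I a ap; rewrite sE reflection_self // mulmxN heightN oppr_lt0.
  rewrite ltNge ltW //= (parabolic_pos_opp PhiJ) ?(parabolic_posE PhiJ) w'r //=.
  by move/negbT; rewrite -leNgt le_eqVlt eq_sym (negPf (parabolic_height PhiJ (w'r _ ar))).
Qed.

End Restriction.

Section Decomposition.

Variables (R : realFieldType) (n : nat).
Local Notation V := 'cV[R]_n.
Implicit Types (v b : V) (J : {set 'I_n}) (Phi : root_data R n).

Lemma irreducible_eq Phi Phi' :
  Defs.roots Phi =i Defs.roots Phi' -> irreducible Phi -> irreducible Phi'.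
Proof.
move=> eqr [ne irr]; split=> [r0|[A [B [A0 B0 rE orth]]]]; last first.
  by apply: irr; exists A, B; split=> // b; rewrite eqr rE.
apply: ne; case: (Defs.roots Phi) eqr => // b s /(_ b).
by rewrite r0 inE eqxx.
Qed.

(** Induction on the number of listed roots: decompose the two orthogonal parts of a reducible
    system and concatenate. As 0 is not a root, the parts are disjoint, hence each has fewer
    roots. *)
Lemma decomposition_exists Phi : 0 \notin Defs.roots Phi -> Defs.roots Phi <> [::] ->
  exists k (U : 'I_k -> {vspace V}), decomposition Phi U.
Proof.
have [m] := ubnP (size (Defs.roots Phi)).
elim: m Phi => // m IH Phi; rewrite ltnS => sz n0 ne.
have [[A [B [A0 B0 rE orth]]]|irr] := classic (reducible Phi); last first.
  have subE : [seq a <- Defs.roots Phi | a \in <<Defs.roots Phi>>%VS] = Defs.roots Phi.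
    by apply/all_filterP/allP => b; apply: memv_span.
  exists 1%N, (fun=> <<Defs.roots Phi>>%VS); split=> [i|i|a ar|i j]; rewrite /= ?subE //.
  - by apply: irreducible_eq (conj ne irr) => b; rewrite /= subE.
  - by exists ord0; apply: memv_span.
  - by rewrite !ord1.
have nself b : b \in A -> b \in B -> False.
  move=> bA bB; move/negP: n0; apply; rewrite -(dot_eq0 (orth _ _ bA bB)) rE.
  by rewrite mem_cat bA.
pose PhiX (X : seq V) := RootData [seq b <- Defs.roots Phi | b \in X] [::] [::].
have part (X Y : seq V) : X <> [::] -> Y <> [::] ->
    (forall b, b \in Defs.roots Phi <-> b \in X \/ b \in Y) ->
    (forall a b, a \in X -> b \in Y -> dot a b = 0) ->
    exists k (U : 'I_k -> {vspace V}), decomposition (PhiX X) U /\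
      forall i, Defs.roots (subsystem Phi (U i)) =i Defs.roots (subsystem (PhiX X) (U i)).
  move=> X0 Y0 rXY oXY.
  have dis b : b \in X -> b \in Y -> False.
    move=> bX bY; move/negP: n0; apply; rewrite -(dot_eq0 (oXY _ _ bX bY)).
    by apply/rXY; left.
  have [|||k [U dec]] := IH (PhiX X).
  - apply: leq_trans sz; rewrite size_filter -(count_predC (mem X)) -addn1 leq_add2l.
    rewrite -has_count; case: Y Y0 dis {oXY} rXY => // y Y _ dis rXY.
    apply/hasP; exists y; first by apply/rXY; right; rewrite inE eqxx.
    by apply/negP => /dis; apply; rewrite inE eqxx.
  - by rewrite mem_filter (negPf n0) andbF.
  - case: X X0 rXY {dis oXY} => // x X _ rXY.
    have : x \in [seq b <- Defs.roots Phi | b \in x :: X].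
      by rewrite mem_filter inE eqxx; apply/rXY; left; rewrite inE eqxx.
    by rewrite /=; case: (filter _ _).
  exists k, U; split=> // i b; rewrite !mem_filter.
  case bU : (b \in U i) => //=; case br : (b \in _); rewrite ?andbF // andbT.
  (* A root of [Y] inside [U i], which is spanned by roots of [X], would be orthogonal to itself. *)
  have /rXY[-> //|bY] := br; case: dec => /(_ i) Ui _ _ _; exfalso.
  suff b0 : b = 0 by rewrite -b0 br in n0.
  apply: dot_eq0; move: bU; rewrite Ui; apply: dot_span => x.
  by rewrite !mem_filter => /and3P[_ xX _]; rewrite dotC oXY.
have [|k1 [U1 [dec1 r1]]] := part A B A0 B0 _ orth.
  by move=> b; rewrite rE mem_cat; split=> /orP.
have [||k2 [U2 [dec2 r2]]] := part B A B0 A0 _ _.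
- by move=> b; rewrite rE mem_cat orbC; split=> /orP.
- by move=> a b aB bA; rewrite dotC orth.
exists (k1 + k2)%N, (fun i => match split i with inl i1 => U1 i1 | inr i2 => U2 i2 end).
case: dec1 => s1 i1 c1 o1; case: dec2 => s2 i2 c2 o2.
split=> [i|i|a ar|i j a b].
- case: (split i) => i'; [rewrite {1}s1|rewrite {1}s2]; apply: eq_span => b.
    by rewrite r1.
  by rewrite r2.
- case: (split i) => i'.
    by apply: irreducible_eq (i1 i') => b; rewrite r1.
  by apply: irreducible_eq (i2 i') => b; rewrite r2.
- have := ar; rewrite rE mem_cat => /orP[aA|aB].
    have [|t at1] := c1 a; first by rewrite mem_filter aA.
    by exists (lshift k2 t); rewrite (unsplitK (inl t)).
  have [|t at2] := c2 a; first by rewrite mem_filter aB.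
  by exists (rshift k1 t); rewrite (unsplitK (inr t)).
- move=> ij; have : split i != split j by rewrite (inj_eq (can_inj (@splitK _ _))).
  have inA t x : x \in Defs.roots (subsystem (PhiX A) (U1 t)) -> x \in A.
    by rewrite !mem_filter => /and3P[].
  have inB t x : x \in Defs.roots (subsystem (PhiX B) (U2 t)) -> x \in B.
    by rewrite !mem_filter => /and3P[].
  case: (split i) => i'; case: (split j) => j' ij'; rewrite ?r1 ?r2.
  + by apply: o1; apply: contraNneq ij' => ->.
  + by move=> /inA aA /inB bB; apply: orth.
  + by move=> /inB aB /inA bA; rewrite dotC; apply: orth.
  + by apply: o2; apply: contraNneq ij' => ->.
Qed.

End Decomposition.

(** * Pivots *)

Section Pivot.

Variables (R : realFieldType) (n : nat).
Local Notation V := 'cV[R]_n.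
Local Notation bv := (@basis_vec R n).
Local Notation e i := (basis_vec R (false, i)).
Implicit Types (v b : V) (J : {set 'I_n}) (Phi : root_data R n).

(** Supports are intervals: [[0, j]] for [e j] and [e j + e i], and [(i, j]] for [e j - e i]. *)
Lemma pos_root_shape Phi J b : parabolic Phi J -> b \in pos_roots Phi ->
  (exists2 j, b = e j & forall c : 'I_n, (c <= j)%N -> c \in J) \/
  exists (i j : 'I_n) s, [/\ (i < j)%N, b = e j + bv (s, i) &
    (forall c : 'I_n, (i < c <= j)%N -> c \in J) /\
    (s = false -> forall c : 'I_n, (c <= j)%N -> c \in J)].
Proof.
move=> PhiJ; rewrite (parabolic_pos PhiJ) => /andP[/posBP[[j ->]|[i [j [s [ij ->]]]]]].
  move=> /supportedP bJ; left; exists j => // c cj; apply: contraT => /bJ.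
  by rewrite rcoef_basis_vec mul1r cj => /eqP; rewrite oner_eq0.
move=> /supportedP bJ; right; exists i, j, s; split=> //; split=> [c cij|sf c cj].
  apply: contraT => /bJ; rewrite rcoefD !rcoef_basis_vec mul1r /=.
  have [-> ->] : (c <= j)%N = true /\ (c <= i)%N = false by split; lia.
  by move/eqP; rewrite mulr0 addr0 oner_eq0.
apply: contraT => /bJ; rewrite rcoefD !rcoef_basis_vec !mul1r /= sf mul1r cj.
by move/eqP; rewrite -natrD pnatr_eq0.
Qed.

(** With a gap at [q], each root has all its nonzero entries before [q] or all from [q] on. These
    two classes are orthogonal, and contain [alpha p] and [alpha r]. *)
Lemma irreducible_convex Phi J (p q r : 'I_n) :
  parabolic Phi J -> irreducible Phi -> p \in J -> r \in J -> (p < q < r)%N ->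
  q \in J.
Proof.
move=> PhiJ [_ irr] pJ rJ pqr; apply: contraT => qJ; case: irr.
pose lo b := [forall i : 'I_n, (q <= i)%N ==> (b i 0 == 0)].
pose hi b := [forall i : 'I_n, (i < q)%N ==> (b i 0 == 0)].
have entry_bv (x : letter n) (i : 'I_n) : i != x.2 -> bv x i 0 = 0.
  by move=> /negPf ix; rewrite basis_vecE ix mulr0.
have lohi b : b \in pos_roots Phi -> lo b \/ hi b.
  move=> /(pos_root_shape PhiJ)[[j -> jJ]|[i [j [s [ij -> [ijJ _]]]]]].
    have jq : (j < q)%N by rewrite ltnNge; apply: contra qJ; apply: jJ.
    by left; apply/forall_inP => i qi; rewrite entry_bv // -val_eqE /=; lia.
  have [jq|qj] := ltnP j q.
    by left; apply/forall_inP => k qk; rewrite mxE !entry_bv ?addr0 // -val_eqE /=; lia.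
  have qi : (q <= i)%N.
    by rewrite leqNgt; apply: contra qJ => iq; apply: ijJ; rewrite iq.
  by right; apply/forall_inP => k qk; rewrite mxE !entry_bv ?addr0 // -val_eqE /=; lia.
have loN b : lo (- b) = lo b by apply: eq_forallb => i; rewrite mxE oppr_eq0.
have hiN b : hi (- b) = hi b by apply: eq_forallb => i; rewrite mxE oppr_eq0.
have lohi' b : b \in Defs.roots Phi -> lo b || hi b.
  move=> br; have := parabolic_height PhiJ br; rewrite neq_lt => /orP[].
    by rewrite -(parabolic_pos_opp PhiJ) // => /lohi; rewrite loN hiN => /orP.
  by move=> b0; apply/orP/lohi; rewrite (parabolic_posE PhiJ) br b0.
exists [seq b <- Defs.roots Phi | lo b], [seq b <- Defs.roots Phi | hi b]; split.
- have : alpha R p \in [seq b <- Defs.roots Phi | lo b].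
    rewrite mem_filter (alpha_roots PhiJ) // andbT.
    apply/forall_inP => i qi; rewrite alphaE -val_eqE /=.
    have [-> ->] : (i == p :> nat) = false /\ (i.+1 == p) = false by lia.
    by rewrite subrr.
  by case: (filter _ _).
- have : alpha R r \in [seq b <- Defs.roots Phi | hi b].
    rewrite mem_filter (alpha_roots PhiJ) // andbT.
    apply/forall_inP => i qi; rewrite alphaE -val_eqE /=.
    have [-> ->] : (i == r :> nat) = false /\ (i.+1 == r) = false by lia.
    by rewrite subrr.
  by case: (filter _ _).
- move=> b; rewrite mem_cat !mem_filter -andb_orl.
  by apply/idP/andP => [br|[]//]; rewrite br lohi'.
- move=> a b; rewrite !mem_filter => /andP[/forall_inP la _] /andP[/forall_inP hb _].
  apply: big1 => i _; have [qi|iq] := leqP q i.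
    by rewrite (eqP (la _ qi)) mul0r.
  by rewrite (eqP (hb _ iq)) mulr0.
Qed.

(** By convexity [J] is an interval [[p, r]], and a cut of the corresponding entries of [x] at [c]
    makes [alpha c] a pivot, because [M] takes [e j] plus or minus [e i] to height [x j] plus or
    minus [x i]. *)
Lemma pivot_exists Phi J (M : 'M[R]_n) (x : nat -> int) :
  parabolic Phi J -> irreducible Phi ->
  noninterlaced x n -> mixed_increasing x n ->
  (forall i, (i < n)%N -> x i != 0) ->
  {in gtn n &, injective (fun i => `|x i|)} ->
  (forall i, height (M *m e i) = (x i)%:~R) ->
  exists2 c : 'I_n, c \in J &
    (forall b, b \in pos_roots Phi -> 0 < rcoef c b -> height (M *m b) < 0) \/
    (forall b, b \in pos_roots Phi -> 0 < rcoef c b -> 0 < height (M *m b)).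
Proof.
move=> PhiJ irr xP xM x0 xI MxE.
have hgt (i j : 'I_n) s : height (M *m (e j + bv (s, i))) = (x j + (-1) ^+ s * x i)%:~R.
  rewrite mulmxDr heightD MxE rmorphD /=; congr (_ + _).
  by case: s; rewrite ?basis_vecN ?mulmxN ?heightN MxE ?mulN1r ?mul1r // rmorphN.
have [c0 c0J] : exists c, c \in J.
  case: (irr); case E: (Defs.roots Phi) => [//|b s] _ _.
  have br : b \in Defs.roots Phi by rewrite E inE eqxx.
  case: (pickP (mem J)) => [c cJ|J0]; first by exists c.
  have := parabolic_neq0 PhiJ br; rewrite (parabolic_sum PhiJ br) big_pred0 ?eqxx //.
have [p pJ pmin] := arg_minnP (@nat_of_ord n) c0J.
have [r rJ rmax] := arg_maxnP (@nat_of_ord n) c0J.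
have inJ (c : 'I_n) : (p <= c <= r)%N -> c \in J.
  move=> pcr; have [->//|cp] := eqVneq c p; have [->//|cr] := eqVneq c r.
  apply: (irreducible_convex PhiJ irr pJ rJ).
  by move: cp cr; rewrite -!val_eqE /=; lia.
have [p0|ppos] := posnP p.
(* Here the entries are those of index at most [r], and their signs matter. For [c <= i] the root
   [e j - e i] has coefficient 0 at [c], and [e j + e i] adds two upper entries of equal sign; for
   [i < c <= j] the entry [x j] dominates. *)
- have [c cr [lt sgn]] := signed_prefix_cut xP xM x0 xI (ltn_ord r).
  have cn : (c < n)%N by apply: leq_ltn_trans cr (ltn_ord r).
  have cJ : Ordinal cn \in J by apply: inJ; rewrite p0.
  exists (Ordinal cn) => //.
  case: sgn => sgn; [right|left] => b /(pos_root_shape PhiJ)[[j -> jJ]|[i [j [s [ij -> [ijJ _]]]]]].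
  + have jr := rmax _ (jJ j (leqnn j)); rewrite rcoef_basis_vec MxE ltr0z mul1r /=.
    by case: leqP => cj; rewrite ?ltxx // => _; apply: sgn; rewrite cj.
  + have jr : (j <= r)%N by apply/rmax/ijJ; rewrite ij leqnn.
    rewrite hgt ltr0z rcoefD !rcoef_basis_vec /= mul1r; have [ci|ic] := leqP c i.
      rewrite (leq_trans ci (ltnW ij)) mulr1.
      case: s {ijJ} => [|_]; first by rewrite expr1 addrN ltxx.
      by rewrite expr0 mul1r; have := sgn i; have := sgn j; lia.
    case: leqP => cj; rewrite ?mulr0 ?addr0 ?ltxx // => _.
    by have := lt i j ic; have := sgn j; case: s {ijJ}; rewrite /= ?expr0 ?expr1; lia.
  + have jr := rmax _ (jJ j (leqnn j)); rewrite rcoef_basis_vec MxE ltrz0 mul1r /=.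
    by case: leqP => cj; rewrite ?ltxx // => _; apply: sgn; rewrite cj.
  + have jr : (j <= r)%N by apply/rmax/ijJ; rewrite ij leqnn.
    rewrite hgt ltrz0 rcoefD !rcoef_basis_vec /= mul1r; have [ci|ic] := leqP c i.
      rewrite (leq_trans ci (ltnW ij)) mulr1.
      case: s {ijJ} => [|_]; first by rewrite expr1 addrN ltxx.
      by rewrite expr0 mul1r; have := sgn i; have := sgn j; lia.
    case: leqP => cj; rewrite ?mulr0 ?addr0 ?ltxx // => _.
    by have := lt i j ic; have := sgn j; case: s {ijJ}; rewrite /= ?expr0 ?expr1; lia.
- have n0 : (0 < n)%N by apply: leq_ltn_trans (ltn_ord p).
  have zeroJ : Ordinal n0 \notin J.
    by apply/negP=> /pmin; rewrite leqNgt ppos.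
  have xI' : {in gtn n &, injective x}.
    by move=> i j iJ jJ xij; apply: xI; rewrite //= xij.
  (* The stretch starts at [p.-1] because [alpha p] is [e p - e p.-1]. Without [alpha 0], only
     differences [e j - e i] remain. *)
  have [|c pcr lt] := @interval_cut x n p.-1 r xP xI'.
    by rewrite ltn_ord andbT; have := pmin r rJ; lia.
  have cn : (c < n)%N by apply: leq_ltn_trans (ltn_ord r); lia.
  have cJ : Ordinal cn \in J by apply: inJ => /=; lia.
  have shape b : b \in pos_roots Phi -> 0 < rcoef c b ->
      exists i j : 'I_n, [/\ (p.-1 <= i < c)%N, (c <= j <= r)%N & b = e j + bv (true, i)].
    move=> /(pos_root_shape PhiJ)[[j -> jJ]|[i [j [[] [ij -> [ijJ jJ]]]]]].
    - by case/negP: zeroJ; apply: jJ.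
    - rewrite rcoefD !rcoef_basis_vec /= => cb; exists i, j.
      have jr : (j <= r)%N by apply/rmax/ijJ; rewrite ij leqnn.
      have in1 : (i.+1 < n)%N by apply: leq_ltn_trans ij (ltn_ord j).
      have pi : (p <= i.+1)%N.
        by apply: (pmin (Ordinal in1)); apply: ijJ => /=; lia.
      move: cb; case: leqP => cj; case: leqP => ci;
        rewrite ?mulr0 ?mulr1 ?expr1 ?addrN ?addr0 ?ltxx // => _.
      - by split=> //; lia.
      - by split=> //; lia.
    - by case/negP: zeroJ; apply: jJ.
  exists (Ordinal cn) => //.
  case: lt => lt; [right|left] => b bp /(shape b bp)[i [j [ic cj ->]]].
    by rewrite hgt ltr0z mulN1r subr_gt0 lt.
  by rewrite hgt ltrz0 mulN1r subr_lt0 lt.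
Qed.

End Pivot.

(** * Signed patterns *)

(** Indexing by natural numbers, with default value 0, allows the cut lemmas to speak of bare
    integer sequences. *)
Definition entry_at n (w : {perm letter n}) (k : nat) : int := nth 0 (one_line w) k.

Section SignedPermutation.

Variables (n : nat) (w : {perm letter n}).
Local Notation x := (entry_at w).

Lemma entry_atE (i : 'I_n) : x i = entry w i.
Proof. by rewrite /entry_at /one_line (nth_map i) ?size_enum_ord // nth_ord_enum. Qed.

Lemma size_one_line : size (one_line w) = n.
Proof. by rewrite size_map size_enum_ord. Qed.

Hypothesis ws : w \in signed_perms n.

Lemma signed_perm_opp y : w (letter_opp y) = letter_opp (w y).
Proof. by move: ws; rewrite inE => /forallP/(_ y)/eqP. Qed.

Lemma entry_at_neq0 i : (i < n)%N -> x i != 0.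
Proof.
move=> ilt; rewrite -[i]/(nat_of_ord (Ordinal ilt)) entry_atE.
by rewrite /entry /letter_val mulf_neq0 ?signr_eq0.
Qed.

(** If the signs of [w y] and [w z] differ, then [w y] is the image of the opposite of [z]. *)
Lemma signed_perm_inj2 y z : (w y).2 = (w z).2 -> y.2 = z.2.
Proof.
move=> yz; have [wyz|wyz] := eqVneq (w y).1 (w z).1.
  by have /perm_inj -> : w y = w z by move: wyz yz; case: (w y) (w z) => ? ? [? ?] /= -> ->.
have /perm_inj -> : w y = w (letter_opp z).
  rewrite signed_perm_opp; move: wyz yz; case: (w y) (w z) => s i [t j] /= + ->.
  by rewrite /letter_opp /= -addbT -negb_add; case: s t => [] [].
by [].
Qed.

Lemma entry_at_inj : {in gtn n &, injective (fun i => `|x i|)}.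
Proof.
move=> i j; rewrite !inE => ilt jlt.
rewrite -[i]/(nat_of_ord (Ordinal ilt)) -[j]/(nat_of_ord (Ordinal jlt)) !entry_atE.
rewrite /entry /letter_val !normrM !normrX !normrN1 !expr1n !mul1r => -[].
by move/val_inj/signed_perm_inj2 => [].
Qed.

End SignedPermutation.

Lemma signed_permutation_exists (p : seq int) :
  perm_eq [seq `|a|%N | a <- p] (iota 1 (size p)) ->
  exists2 u : {perm letter (size p)}, u \in signed_perms (size p) & one_line u = p.
Proof.
move=> pP; have pin i : (i < size p)%N -> (0 < absz (p`_i)%R <= size p)%N.
  move=> ip; have : absz (p`_i)%R \in iota 1 (size p).
    by rewrite -(perm_mem pP) map_f ?mem_nth.
  by rewrite mem_iota; lia.
have lt (i : 'I_(size p)) : ((absz (p`_i)%R).-1 < size p)%N by have := pin _ (ltn_ord i); lia.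
(* The predecessor appears because index [k] of a letter stands for [k.+1]. *)
pose f (y : letter (size p)) : letter (size p) := (y.1 (+) (p`_(y.2) < 0), Ordinal (lt y.2)).
have f_inj : injective f.
  move=> [s i] [t j] [+ ij]; have eij : i = j.
    apply/val_inj/eqP; rewrite /= -(nth_uniq 0%N (s := [seq `|a|%N | a <- p])) ?size_map //.
      rewrite !(nth_map 0) //; have := pin _ (ltn_ord i); have := pin _ (ltn_ord j);
        move: ij; move: (absz _) (absz _) => a b; lia.
    by rewrite (perm_uniq pP) iota_uniq.
  by rewrite eij => /addIb ->.
have uE i : entry (perm f_inj) i = p`_i.
  rewrite /entry permE /letter_val /=; have := pin _ (ltn_ord i).
  by move: (p`_i) => q; case: ltP => p0; rewrite ?expr0 ?expr1; lia.
exists (perm f_inj).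
  by rewrite inE; apply/forallP=> y; rewrite !permE /f /letter_opp /= addNb.
apply: (@eq_from_nth _ 0); first exact: size_one_line.
move=> i; rewrite size_one_line => ip.
by have := entry_atE (perm f_inj) (Ordinal ip); rewrite uE.
Qed.

(** The condition on [p] provides the signed permutation with this one-line notation. Positions
    become a function on naturals, so that explicit lists of positions can be supplied through
    [nth]. *)
Lemma avoidsP n (w : {perm letter n}) p : perm_eq [seq `|a|%N | a <- p] (iota 1 (size p)) ->
  avoids w p <-> forall g : nat -> nat,
    (forall i, (i < size p)%N -> (g i < n)%N) ->
    (forall i j, (i < j < size p)%N -> (g i < g j)%N) ->
    (forall i, (i < size p)%N -> (p`_i < 0) = (entry_at w (g i) < 0)) ->
    (forall i j, (i < j < size p)%N ->
       (`|p`_i| < `|p`_j|) = (`|entry_at w (g i)| <= `|entry_at w (g j)|)) -> False.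
Proof.
move=> pP; split=> [av g gn gm gs go|av].
  apply: av; have [u us up] := signed_permutation_exists pP; exists u; split=> //.
  have ue i : entry u i = p`_i by rewrite -entry_atE /entry_at up.
  exists (fun i : 'I_(size p) => Ordinal (gn i (ltn_ord i))) => [i j ij|].
    by apply: gm; rewrite ij /=.
  split=> // [i|i j ij]; rewrite !ue -!entry_atE /=; first exact: gs.
  by apply: go; rewrite ij /=.
case=> u [up [f fm [us fs fo]]].
have ue i : entry u i = p`_i by rewrite -entry_atE /entry_at up.
(* For the empty pattern all conditions on [g] are vacuous; otherwise position 0 serves as default
   to extend [f] to all naturals. *)
case: (posnP (size p)) => [p0|ppos].
  by apply: (av id) => [i|i j|i|i j]; rewrite p0 ?ltn0 ?andbF.
pose g i := nat_of_ord (f (insubd (Ordinal ppos) i)).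
have gE i (ip : (i < size p)%N) : g i = f (Ordinal ip).
  by rewrite /g; congr (nat_of_ord (f _)); apply/val_inj; rewrite val_insubd ip.
apply: (av g) => [i ip|i j /andP[ij jp]|i ip|i j /andP[ij jp]].
- by rewrite gE.
- have ip := ltn_trans ij jp; rewrite (gE _ ip) (gE _ jp); exact: fm.
- by rewrite gE entry_atE -fs ue.
- have ip := ltn_trans ij jp; rewrite (gE _ ip) (gE _ jp) !entry_atE -fo //.
  by rewrite !ue.
Qed.

(** The patterns of length 2 amount to [mixed_increasing]. Given that, four entries ordered like
    2413 or 3142 have the same sign, and each of the four longer patterns is one of these orders
    with one sign. *)
Lemma avoids_six_patterns n (w : {perm letter n}) : w \in signed_perms n ->
  (avoids w [:: -2; 1] /\ avoids w [:: 2; -1] /\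
   avoids w [:: 3; 1; 4; 2] /\ avoids w [:: 2; 4; 1; 3] /\
   avoids w [:: -3; -1; -4; -2] /\ avoids w [:: -2; -4; -1; -3]) <->
  mixed_increasing (entry_at w) n /\ noninterlaced (entry_at w) n.
Proof.
move=> ws; have x0 := @entry_at_neq0 n w; have xI := entry_at_inj ws.
rewrite !avoidsP //; set x := entry_at w in x0 xI *.
have xn a b : (a < b < n)%N -> `|x a| != `|x b|.
  by move=> abn; apply/eqP => /xI; rewrite !inE; lia.
split=> [[a1 [a2 [a3 [a4 [a5 a6]]]]]|[xM xP]]; last first.
  split; [|split; [|split; [|split; [|split]]]] => g gn gm gs go.
  1,2: have := gm 0%N 1%N isT; have := gn 1%N isT => g1n g01;
    have := gs 0%N isT; have := gs 1%N isT; have := go 0%N 1%N isT;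
    have := xM (g 0%N) (g 1%N); have := x0 _ (gn 0%N isT); have := x0 _ (gn 1%N isT);
    rewrite /=; lia.
  (* A pattern gives only weak inequalities where its absolute values increase; distinctness of
     absolute values makes them strict. *)
  1-4: have lt01 := gm 0%N 1%N isT; have lt12 := gm 1%N 2%N isT;
    have lt23 := gm 2%N 3%N isT; have g3n := gn 3%N isT;
    have n02 : `|x (g 0%N)| != `|x (g 2%N)| by apply: xn; clear -lt01 lt12 lt23 g3n; lia.
  1-4: have n03 : `|x (g 0%N)| != `|x (g 3%N)| by apply: xn; clear -lt01 lt12 lt23 g3n; lia.
  1-4: have n13 : `|x (g 1%N)| != `|x (g 3%N)| by apply: xn; clear -lt01 lt12 lt23 g3n; lia.
  1-4: have [] := xP (g 0%N) (g 1%N) (g 2%N) (g 3%N); rewrite ?lt01 ?lt23 //.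
  1-4: move: n02 n03 n13 (go 0%N 2%N isT) (go 0%N 3%N isT) (go 1%N 3%N isT)
       (gs 0%N isT) (gs 1%N isT) (gs 2%N isT) (gs 3%N isT)
       (x0 _ (gn 0%N isT)) (x0 _ (gn 1%N isT)) (x0 _ (gn 2%N isT)) (x0 _ (gn 3%N isT)).
  1-4: move: (x (g 0%N)) (x (g 1%N)) (x (g 2%N)) (x (g 3%N)) => y0 y1 y2 y3 /=.
  1-4: clear; lia.
have xM : mixed_increasing x n.
  move=> i j /andP[ij jn] sij; rewrite ltNge; apply/negP => xji.
  have iltn := ltn_trans ij jn.
  have neij : `|x i| != `|x j| by apply: xn; rewrite ij.
  have := x0 i iltn; have := x0 j jn => xj xi.
  clear a3 a4 a5 a6 xn xI x0.
  (* The sign of [x i] decides which of the two patterns occurs at positions [i], [j]. *)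
  have [xi0|xi0] := ltP (x i) 0; [apply: (a1 (nth 0%N [:: i; j]))|apply: (a2 (nth 0%N [:: i; j]))].
  1-8: clear a1 a2.
  1-8: try by case=> [|[|k]] //=; lia.
  1-4: by case=> [|[|k]] [|[|l]] //=; lia.
split=> // i j k l ijk kln.
have gn (m : nat) : (m < 4)%N -> (nth 0%N [:: i; j; k; l] m < n)%N.
  by clear -ijk kln; case: m => [|[|[|[|m]]]] //=; lia.
have gm (m m' : nat) : (m < m' < 4)%N ->
    (nth 0%N [:: i; j; k; l] m < nth 0%N [:: i; j; k; l] m')%N.
  by clear -ijk kln; case: m m' => [|[|[|[|m]]]] [|[|[|[|m']]]] //=; lia.
have sgn : [|| [&& 0 < x i, 0 < x j, 0 < x k & 0 < x l],
  [&& x i < 0, x j < 0, x k < 0 & x l < 0] |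
  ~~ ([&& x k < x i, x i < x l & x l < x j] || [&& x j < x l, x l < x i & x i < x k])].
  have [lij lik lil] : [/\ (i < j < n)%N, (i < k < n)%N & (i < l < n)%N].
    by clear -ijk kln; split; lia.
  have [ljk ljl lkl] : [/\ (j < k < n)%N, (j < l < n)%N & (k < l < n)%N].
    by clear -ijk kln; split; lia.
  move: (xM _ _ lij) (xM _ _ lik) (xM _ _ lil) (xM _ _ ljk) (xM _ _ ljl) (xM _ _ lkl).
  move: (x0 _ (gn 0%N isT)) (x0 _ (gn 1%N isT)) (x0 _ (gn 2%N isT)) (x0 _ (gn 3%N isT)).
  by rewrite /=; move: (x i) (x j) (x k) (x l) => y0 y1 y2 y3; clear; lia.
split=> -[lt1 [lt2 lt3]]; have := sgn; rewrite lt1 lt2 lt3 ?orbT ?orbF.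
  (* Negative values reverse the order of absolute values, so the value order 2413 comes from 2413
     or from the negated 3142; the other order is symmetric. *)
  case/orP=> /and4P[s0 s1 s2 s3]; [apply: (a4 _ gn gm) | apply: (a5 _ gn gm)].
  1-4: clear -lt1 lt2 lt3 s0 s1 s2 s3.
  1,3: by case=> [|[|[|[|m]]]] //=; lia.
  1-2: by case=> [|[|[|[|m]]]] [|[|[|[|m']]]] //=; lia.
case/orP=> /and4P[s0 s1 s2 s3]; [apply: (a3 _ gn gm) | apply: (a6 _ gn gm)].
all: clear -lt1 lt2 lt3 s0 s1 s2 s3.
1,3: by case=> [|[|[|[|m]]]] //=; lia.
all: by case=> [|[|[|[|m]]]] [|[|[|[|m']]]] //=; lia.
Qed.

(** * Separability in type B *)

Section Separability.

Variables (R : realFieldType) (n : nat).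
Local Notation V := 'cV[R]_n.
Local Notation bv := (@basis_vec R n).
Local Notation e i := (basis_vec R (false, i)).
Local Notation rootsB := (Defs.roots (typeB R n)).
Implicit Types (v b : V) (J : {set 'I_n}) (Phi : root_data R n).

Lemma signed_perm_mxE (w : {perm letter n}) y : w \in signed_perms n ->
  signed_perm_mx R w *m bv y = bv (w y).
Proof.
case: y => s j ws; rewrite {1}/basis_vec -scalemxAr -colE.
have -> : col j (signed_perm_mx R w) = bv (w (false, j)).
  by apply/matrixP=> i k; rewrite ord1 2!mxE.
case: s; last by rewrite scale1r.
by rewrite -[(true, j)]/(letter_opp (false, j)) signed_perm_opp // basis_vec_opp scaleN1r.
Qed.

Lemma signed_perm_mx_roots (w : {perm letter n}) b : w \in signed_perms n ->
  b \in rootsB -> signed_perm_mx R w *m b \in rootsB.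
Proof.
move=> ws; apply: (rootsB_letter_map (f := w)) => [y|y z yz].
  exact: signed_perm_mxE.
by apply: contra_neq yz; apply: signed_perm_inj2.
Qed.

Lemma height_signed_perm_mx (w : {perm letter n}) i : w \in signed_perms n ->
  height (signed_perm_mx R w *m e i) = (entry_at w i)%:~R.
Proof. by move=> ws; rewrite signed_perm_mxE // height_basis_vec entry_atE. Qed.

Lemma size_filter_lt (T : eqType) (s : seq T) (P : pred T) y :
  y \in s -> ~~ P y -> (size [seq z <- s | P z] < size s)%N.
Proof.
move=> ys Py; rewrite size_filter -(count_predC P) -addn1 leq_add2l -has_count.
by apply/hasP; exists y.
Qed.

Section Existence.

Variables (M : 'M[R]_n) (x : nat -> int).
Hypothesis M_roots : forall b, b \in rootsB -> M *m b \in rootsB.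
Hypothesis height_M : forall i, height (M *m e i) = (x i)%:~R.
Hypotheses (xP : noninterlaced x n) (xM : mixed_increasing x n).
Hypothesis x0 : forall i, (i < n)%N -> x i != 0.
Hypothesis xI : {in gtn n &, injective (fun i => `|x i|)}.

(** This ties every successive restriction to one fixed matrix [M], so that the same sequence [x]
    supplies the pivots at all stages. *)
Definition inversions_from Phi (w : 'M[R]_n) : Prop :=
  forall b, b \in pos_roots Phi -> (b \in inversions Phi w) = (height (M *m b) < 0).

Lemma is_restriction_exists Phi J U w : parabolic (subsystem Phi U) J ->
  inversions_from Phi w ->
  exists2 w', is_restriction Phi U w w' & inversions_from (subsystem Phi U) w'.
Proof.
(* The restriction is built from [M] rather than from [w]; their inversions in [Phi] agree. *)
move=> PhiJ wM; have [b|w' [w'W _ w'I]] := restriction_exists PhiJ (w := M).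
  by rewrite (parabolic_roots PhiJ) => /andP[/M_roots/height_rootsB].
have inv : inversions_from (subsystem Phi U) w'.
  by move=> b bp; rewrite mem_filter w'I // bp andbT.
exists w' => //; split=> // b.
have [bp|bn] := boolP (b \in pos_roots (subsystem Phi U)).
  by move: (bp); rewrite inv // !mem_filter => /andP[-> bp']; rewrite -wM // mem_filter.
have -> : (b \in inversions (subsystem Phi U) w') = false.
  by rewrite mem_filter (negPf bn) andbF.
apply/esym; move: bn; rewrite !mem_filter andbCA => /negPf ->.
by rewrite andbF.
Qed.

(** Induction on the number of listed roots, which drops both when a pivot is removed and on passing
    to a component. *)
Lemma separable_exists Phi J w :
  parabolic Phi J -> inversions_from Phi w -> separable Phi w.
Proof.
have [m] := ubnP (size (Defs.roots Phi)).
elim: m Phi J w => // m IH Phi J w; rewrite ltnS => sz PhiJ wM.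
have [r0|/eqP rn0] := eqVneq (Defs.roots Phi) [::]; first exact: separable_trivial.
have [irr|red] := classic (irreducible Phi).
  have [c cJ cut] := pivot_exists PhiJ irr xP xM x0 xI height_M.
  have sub := parabolic_span_minus PhiJ cJ.
  have [w' w'r w'M] := is_restriction_exists sub wM.
  apply: (separable_irreducible irr _ w'r); rewrite ?(parabolic_alpha PhiJ) //.
    apply: IH w'M; last exact: sub.
    apply: leq_trans sz; apply: (size_filter_lt (alpha_roots PhiJ cJ)).
    by rewrite (span_minusE PhiJ) supported_alpha !inE eqxx.
  case: cut => cut; [left|right] => b bp /(root_leP PhiJ cJ bp) bc.
    by rewrite wM ?cut.
  by rewrite wM // -leNgt ltW ?cut.
have [|//|k [U dec]] := @decomposition_exists _ _ Phi.
  by apply/negP => /(parabolic_neq0 PhiJ); rewrite eqxx.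
have /fin_all_exists2[w' w'r w'M] i :=
  is_restriction_exists (parabolic_decomposition PhiJ i dec) wM.
(* A single component would contain every root and make [Phi] irreducible. *)
have k1 : (1 < k)%N.
  case: k U dec {w' w'r w'M} => [|[|//]] U [_ Uirr Ucov _].
    case E: (Defs.roots Phi) rn0 => [//|b s] _.
    have br : b \in Defs.roots Phi by rewrite E inE eqxx.
    by case: (Ucov b br) => -[].
  case: red; apply: irreducible_eq (Uirr ord0) => b; rewrite mem_filter.
  case br: (b \in Defs.roots Phi); rewrite ?andbF // andbT.
  by have [i] := Ucov _ br; rewrite ord1.
apply: (separable_reducible k1 dec w'r) => i.
apply: IH (w'M i); last exact: (parabolic_decomposition PhiJ i dec).
apply: leq_trans sz.
(* A root of another component [j] is nonzero and orthogonal to the roots of [U i], so it is missing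
   from that component. *)
have [j ji] : exists j : 'I_k, j != i.
  case: (pickP (predC1 i)) => [j ji|none]; first by exists j.
  have := cardC1 i; rewrite eq_card0 // card_ord; lia.
case: dec => _ Uirr _ Uorth.
have [b bj] : exists b, b \in Defs.roots (subsystem Phi (U j)).
  case: (Uirr j) => + _; case: (Defs.roots _) => // b s _.
  by exists b; rewrite inE eqxx.
have br : b \in Defs.roots Phi by move: bj; rewrite mem_filter => /andP[].
apply: (size_filter_lt br); apply/negP=> bi.
have bi' : b \in Defs.roots (subsystem Phi (U i)) by rewrite mem_filter bi.
by have := parabolic_neq0 PhiJ br; rewrite (dot_eq0 (Uorth _ _ _ _ ji bj bi')) eqxx.
Qed.

End Existence.

Lemma inversions_typeB (w : {perm letter n}) : w \in signed_perms n ->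
  inversions_from (signed_perm_mx R w) (typeB R n) (signed_perm_mx R w).
Proof.
move=> ws b bp; rewrite mem_filter [_ \in pos_roots _]bp andbT posB_opp //.
by rewrite signed_perm_mx_roots // rootsBE bp.
Qed.

Lemma separable_typeB (w : {perm letter n}) : w \in signed_perms n ->
  separable (typeB R n) (signed_perm_mx R w) <->
  mixed_increasing (entry_at w) n /\ noninterlaced (entry_at w) n.
Proof.
move=> ws; set M := signed_perm_mx R w; set x := entry_at w.
have x0 := @entry_at_neq0 n w; have xI := entry_at_inj ws.
have hM i : height (M *m e i) = (x i)%:~R by apply: height_signed_perm_mx.
split=> [/separable_interlace_free/(_ _ (@parabolic_typeB R n))[mix int]|[xM xP]]; last first.
  apply: (separable_exists _ hM xP xM x0 xI (parabolic_typeB R n)).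
    by move=> b; apply: signed_perm_mx_roots.
  exact: inversions_typeB.
have pe i : e i \in posB R n by apply/posBP; left; exists i.
have pd (i j : 'I_n) : (i < j)%N -> e j - e i \in posB R n.
  by move=> ij; apply/posBP; right; exists i, j, true; rewrite basis_vecN.
have ps (i j : 'I_n) : (i < j)%N -> e j + e i \in posB R n.
  by move=> ij; apply/posBP; right; exists i, j, false.
have inv b : b \in posB R n -> (b \in inversions (typeB R n) M) = (height (M *m b) < 0).
  exact: inversions_typeB.
have inve i : (e i \in inversions (typeB R n) M) = (x i < 0).
  by rewrite inv // hM ltrz0.
have invd (i j : 'I_n) : (i < j)%N ->
    (e j - e i \in inversions (typeB R n) M) = (x j < x i).
  move=> ij; rewrite inv ?pd // mulmxDr mulmxN heightD heightN !hM.
  by rewrite subr_lt0 ltr_int.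
split.
  move=> i j /andP[ij jn] sg.
  have iltn := ltn_trans ij jn; pose i' := Ordinal iltn; pose j' := Ordinal jn.
  have := mix i' j' ij; rewrite !inE !inve inv ?ps // mulmxDr heightD !hM.
  rewrite -intrD ltrz0 /= => mixij.
  (* For opposite signs, [x j + x i] has the sign of [x j] exactly when [|x i| < |x j|], equality
     being excluded by [nij]. *)
  have {}mixij : (x j + x i < 0) = (x j < 0).
    apply: mixij => // b; rewrite !inE => /or4P[]/eqP -> //; [exact: pd|exact: ps].
  have nij : `|x i| != `|x j| by apply/eqP => /xI; rewrite !inE; lia.
  move: sg mixij nij (x0 i iltn) (x0 j jn); clear; lia.
move=> i j k l ijk kln.
have jn : (j < n)%N by lia.
have lin : (i < n)%N by lia.
have kn : (k < n)%N by lia.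
have ln : (l < n)%N by lia.
have [ij ik il] : [/\ i < j, i < k & i < l]%N by split; lia.
have [jk jl kl] : [/\ j < k, j < l & k < l]%N by split; lia.
have sub : {subset differences R (Ordinal lin) (Ordinal jn) (Ordinal kn) (Ordinal ln)
    <= pos_roots (typeB R n)}.
  move=> b; rewrite !inE => /orP[/eqP->|/orP[/eqP->|/orP[/eqP->|/or3P[]/eqP->]]];
  exact: pd.
have := int (Ordinal lin) (Ordinal jn) (Ordinal kn) (Ordinal ln) ijk kl sub.
rewrite /order_pattern !inE !invd // !eqseq_cons !eqbF_neg !eqb_id !eqxx /=.
by move: (x i) (x j) (x k) (x l) => y0 y1 y2 y3; clear; lia.
Qed.

End Separability.

Theorem lemma3p5 (R : realFieldType) (n : nat) (w : {perm letter n}) :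
  (2 <= n)%N -> w \in signed_perms n ->
  (separable (typeB R n) (signed_perm_mx R w) <->
   avoids w [:: -2; 1] /\
   avoids w [:: 2; -1] /\
   avoids w [:: 3; 1; 4; 2] /\
   avoids w [:: 2; 4; 1; 3] /\
   avoids w [:: -3; -1; -4; -2] /\
   avoids w [:: -2; -4; -1; -3]).
Proof. by move=> _ ws; rewrite separable_typeB // avoids_six_patterns. Qed.
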